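(* Suppose that to every convex quadrilateral $K\subset\mathbb{R}^2$ there is assigned a finite element in the sense of Ciarlet $(K,P_K,N_K)$, where $P_K$ is a (finite-dimensional) space of polynomials on $K$ and $N_K$ is a set of nodal parameters unisolvent for $P_K$. Suppose that on every grid $\mathcal{J}$ consisting of arbitrary convex quadrilaterals, the finite element space generated on $\mathcal{J}$ by the continuity of the nodal parameters is a subspace of $H^1(\Omega_{\mathcal{J}})$, where $\Omega_{\mathcal{J}}$ is the domain covered by the cells of $\mathcal{J}$. Then, for every $K$, the space $P_K$ contains only polynomials that vanish on the boundary $\partial K$.
   Context: A grid is a finite collection of convex quadrilaterals (cells) such that any two distinct cells that intersect share exactly one vertex or exactly one whole edge. Ciarlet's triple: $N_K$ is a finite set of linear functionals (nodal parameters) that forms a basis of the dual space of $P_K$. As usual, each nodal parameter of $K$ is attached to a vertex of $K$, to an edge of $K$, or to the interior of $K$. When two cells of a grid share a vertex (respectively an edge), the nodal parameters of the two cells attached to this vertex (respectively edge) are identified with one another, as common nodal parameters; parameters attached to the interior of a cell belong to that cell only. The finite element space generated on a grid $\mathcal{J}$ by the continuity of the nodal parameters is the space of all functions $v$ with $v|_K\in P_K$ for each $K\in\mathcal{J}$ such that every common nodal parameter takes the same value when evaluated on the restrictions of $v$ to the cells sharing it. In particular the values of the (identified) nodal parameters can be prescribed arbitrarily and determine $v$ uniquely. *)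

(* Defs.v *)
From HB Require Import structures.
From mathcomp Require Import all_boot all_order all_algebra.
From mathcomp Require Import polyXY.
From mathcomp Require Import all_classical all_reals all_analysis.

Set Implicit Arguments.
Unset Strict Implicit.
Unset Printing Implicit Defensive.

Import Order.TTheory GRing.Theory Num.Theory.
Import numFieldNormedType.Exports.

Local Open Scope classical_set_scope.
Local Open Scope ring_scope.

Section Quadrilaterals.
Variable R : realType.
Implicit Types (a b c d : R * R) (K e : set (R * R)) (J : set (set (R * R))).

(* Twice the signed area of the triangle a b c; positive iff a, b, c is a
   counterclockwise, non-degenerate triple. *)
Definition orient a b c : R :=
  (b.1 - a.1) * (c.2 - a.2) - (b.2 - a.2) * (c.1 - a.1).

Definition segment a b : set (R * R) :=
  [set (1 - t) *: a + t *: b | t in `[0, 1]].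

Definition hull4 a b c d : set (R * R) :=
  [set z | exists s t u v : R,
     [/\ 0 <= s, 0 <= t, 0 <= u & 0 <= v] /\ s + t + u + v = 1 /\
     z = s *: a + t *: b + u *: c + v *: d].

(* K is the (closed) convex quadrilateral whose vertices are a, b, c, d in
   counterclockwise order. Four strict left turns are exactly strict convexity
   of the polygon a b c d (no three collinear vertices). *)
Definition quad_with_vertices K a b c d : Prop :=
  [/\ 0 < orient a b c, 0 < orient b c d, 0 < orient c d a & 0 < orient d a b]
  /\ K = hull4 a b c d.

Definition convex_quad K : Prop := exists a b c d, quad_with_vertices K a b c d.

(* Cyclic relabelling reaches each vertex and each edge of K, so it suffices to
   look at the first vertex and the first edge of every labelling. *)
Definition is_vertex K a : Prop := exists b c d, quad_with_vertices K a b c d.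

Definition is_edge K e : Prop :=
  exists a b c d, quad_with_vertices K a b c d /\ e = segment a b.

Definition boundary K : set (R * R) := closure K `\` K°.

Definition grid J : Prop :=
  [/\ finite_set J,
      (forall K, J K -> convex_quad K) &
      forall K K', J K -> J K' -> K <> K' -> K `&` K' !=set0 ->
        (exists a, [/\ is_vertex K a, is_vertex K' a & K `&` K' = [set a]]) \/
        (exists e, [/\ is_edge K e, is_edge K' e & K `&` K' = e])].

(* The open set covered by the closed cells, common edges included. *)
Definition grid_domain J : set (R * R) := (\bigcup_(K in J) K)°.

End Quadrilaterals.

Section Sobolev.
Variable R : realType.
Implicit Types (Om : set (R * R)) (u g phi : R * R -> R).

Local Notation mu2 := (@lebesgue_measure R \x @lebesgue_measure R)%E.

Definition dir1 : R * R := (1, 0).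
Definition dir2 : R * R := (0, 1).

Fixpoint Ck (k : nat) phi : Prop :=
  continuous phi /\
  match k with
  | 0 => True
  | k'.+1 => [/\ forall x, derivable phi x dir1, forall x, derivable phi x dir2,
                 Ck k' (fun x => 'D_dir1 phi x) & Ck k' (fun x => 'D_dir2 phi x)]
  end.

Definition test_function Om phi : Prop :=
  (forall k, Ck k phi) /\
  compact (closure [set x | phi x != 0]) /\
  closure [set x | phi x != 0] `<=` Om.

Definition L2 Om u : Prop :=
  measurable_fun Om u /\ mu2.-integrable Om (fun x => (u x ^+ 2)%:E).

Definition weak_derivative Om (v : R * R) u g : Prop :=
  forall phi, test_function Om phi ->
    (\int[mu2]_(x in Om) (u x * 'D_v phi x)%:E =
     - \int[mu2]_(x in Om) (g x * phi x)%:E)%E.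

(* Elements are representatives of classes modulo null sets; their values
   outside Om are irrelevant. *)
Definition H1 Om : set (R * R -> R) :=
  [set u | L2 Om u /\ exists g1 g2,
     [/\ L2 Om g1, L2 Om g2, weak_derivative Om dir1 u g1 &
         weak_derivative Om dir2 u g2]].
End Sobolev.

Section FiniteElements.
Variable R : realType.
Implicit Types (K : set (R * R)) (J : set (set (R * R)))
  (P : set {poly {poly R}}) (l : {poly {poly R}} -> R).

Definition peval (p : {poly {poly R}}) (z : R * R) : R := p.[z.1, z.2].

(* c%:P *: p is the multiple of the bivariate polynomial p by c : R. *)

Definition findim_space P : Prop :=
  exists (m : nat) (b : 'I_m -> {poly {poly R}}),
    P = [set p | exists c : 'I_m -> R, p = \sum_(i < m) (c i)%:P *: b i].

(* The values of l outside P are irrelevant. *)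
Definition linear_on P l : Prop :=
  forall (c : R) p q, P p -> P q -> l (c%:P *: p + q) = c * l p + l q.

Definition dual_basis P (m : nat) (N : 'I_m -> {poly {poly R}} -> R) : Prop :=
  [/\ forall i, linear_on P (N i),
      forall c : 'I_m -> R,
        (forall p, P p -> \sum_(i < m) c i * N i p = 0) -> forall i, c i = 0 &
      forall l, linear_on P l -> exists c : 'I_m -> R,
        forall p, P p -> l p = \sum_(i < m) c i * N i p].

(* The geometric object to which a nodal parameter is attached. *)
Inductive site : Type :=
| AtVertex of R * R
| AtEdge of set (R * R)
| AtInterior.

Definition site_of K (s : site) : Prop :=
  match s with
  | AtVertex a => is_vertex K a
  | AtEdge e => is_edge K e
  | AtInterior => True
  end.

Definition shareable (s : site) : Prop := s <> AtInterior.

Record element := Element {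
  poly_space : set {poly {poly R}};
  nnodes : nat;
  nodal_param : 'I_nnodes -> {poly {poly R}} -> R;
  node_site : 'I_nnodes -> site }.

Definition ciarlet_element K (E : element) : Prop :=
  [/\ findim_space (poly_space E), dual_basis (poly_space E) (@nodal_param E) &
      forall i : 'I_(nnodes E), site_of K (node_site i)].

(* An identification: common K K' i j means that the i-th nodal parameter of K
   and the j-th nodal parameter of K' are the same common parameter. *)
Definition identification (F : set (R * R) -> element) : Type :=
  forall K K', 'I_(nnodes (F K)) -> 'I_(nnodes (F K')) -> Prop.

(* Within a grid, an identification is an equivalence relation on the nodal
   parameters of all cells, trivial on each cell; it relates parameters of
   distinct cells only if both are attached to the same shared vertex or edge,
   and every parameter attached to a shared vertex or edge has a counterpart
   (necessarily unique) in each cell sharing it. *)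
Definition coherent (F : set (R * R) -> element) (common : identification F)
    : Prop :=
  forall J, grid J ->
  [/\ forall K (i j : 'I_(nnodes (F K))), J K -> common K K i j <-> i = j,
      forall K K' i j, J K -> J K' -> common K K' i j -> common K' K j i,
      forall K K' K'' i j k, J K -> J K' -> J K'' ->
        common K K' i j -> common K' K'' j k -> common K K'' i k,
      forall K K' i j, J K -> J K' -> K <> K' -> common K K' i j ->
        shareable (node_site i) /\ node_site i = node_site j &
      forall K K' (i : 'I_(nnodes (F K))), J K -> J K' -> K <> K' ->
        shareable (node_site i) -> site_of K' (node_site i) ->
        exists j, common K K' i j].

(* A function of the space is polynomial in each open cell; p K is its
   polynomial extension to the closed cell K, to which the nodal parameters of
   K apply. The extensions from two cells need not agree on a common edge, where
   v itself is arbitrary (a null set). *)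
Definition fe_space (F : set (R * R) -> element) (common : identification F) J
    : set (R * R -> R) :=
  [set v | measurable_fun (grid_domain J) v /\
     exists p : set (R * R) -> {poly {poly R}},
       (forall K, J K -> poly_space (F K) (p K) /\
          forall z, K° z -> v z = peval (p K) z) /\
       (forall K K' i j, J K -> J K' -> common K K' i j ->
          nodal_param i (p K) = nodal_param j (p K'))].

End FiniteElements.

(* Main.v *)
Require Import Defs.
From mathcomp Require Import all_boot all_order all_algebra.
From mathcomp Require Import polyXY ring lra.
From mathcomp Require Import all_classical all_reals all_analysis.
From mathcomp Require Import measurable_realfun.

(* Two cells K, K' sharing an edge ab: a function of the finite element space
   has square-integrable weak derivatives, so its two polynomial pieces agree on
   ab. (Test against J * bump * c_n, where J is the jump and c_n = 1 on ab is
   supported in a strip of width tending to 0: one side tends to 0 by dominated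
   convergence, the other is the integral of J^2 * bump along ab for every n.)

   Given p in P_K, put across ab a trapezoid K' whose opposite edge c'd' lies on
   a line meeting the line ab at a prescribed point x outside ab. Some q in P_K'
   has the nodal parameters of p on ab and its end points, all others being 0.
   Then p = q on the line ab, while q = 0 on the line c'd', because q extends by
   0 to a further cell across c'd'. So p(x) = 0; since x is arbitrary, p vanishes
   on the line ab. *)

Set Implicit Arguments.
Unset Strict Implicit.
Unset Printing Implicit Defensive.

Import Order.TTheory GRing.Theory Num.Theory.
Import numFieldNormedType.Exports.

Local Open Scope classical_set_scope.
Local Open Scope ring_scope.

(** * Flat functions and smooth functions of the plane *)

Section Flat.
Variable R : realType.
Implicit Types (q : {poly R}) (x : R).

(** The polynomial factor in [x^-1] makes the family closed under differentiation; [q = 1] is the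
    classical smooth function that is flat at 0. *)
Definition flat q x : R := if 0 < x then q.[x^-1] * expR (- x^-1) else 0.

(** With t = 1/x one has d/dx = - t^2 d/dt, and t^2 (q - q') is the new factor of exp(-t). *)
Definition flat_deriv q : {poly R} := 'X^2 * (q - q^`()).

(** Since exp(t) >= t^(i+2) / (i+2)!, each monomial satisfies t^i exp(-t) <= (i+2)! / t^2. The
    quadratic bound yields the derivative at 0. *)
Lemma flat_quadratic q : exists2 C, 0 <= C & forall x, `|flat q x| <= C * x ^+ 2.
Proof.
suff [C C0 hC] : exists2 C : R, 0 <= C &
    forall t : R, 0 < t -> `|q.[t]| * expR (- t) <= C * t ^- 2.
  exists C => // x; rewrite /flat; case: ifPn => [x0|_]; last first.
    by rewrite normr0 mulr_ge0 ?sqr_ge0.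
  rewrite normrM (ger0_norm (expR_ge0 _)).
  by have := hC x^-1; rewrite invr_gt0 => /(_ x0); rewrite exprVn invrK.
elim/poly_ind: q => [|q c _].
  exists 0 => // t _; by rewrite horner0 normr0 !mul0r.
set p := q * 'X + c%:P.
exists (\sum_(i < size p) `|p`_i| * (i.+2)`!%:R).
  by apply: sumr_ge0 => i _; rewrite mulr_ge0.
move=> t t0; rewrite horner_coef [leRHS]mulr_suml.
apply: (@le_trans _ _ (\sum_(i < size p) `|p`_i * t ^+ i| * expR (- t))).
  by rewrite -[leRHS]mulr_suml ler_wpM2r ?expR_ge0 ?ler_norm_sum.
apply: ler_sum => i _; rewrite normrM (ger0_norm (exprn_ge0 _ (ltW t0))).
rewrite -!mulrA ler_wpM2l//.
rewrite expRN ler_pdivrMr ?expR_gt0// mulrAC ler_pdivlMr ?exprn_gt0//.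
rewrite -exprD addn2 mulrC -ler_pdivrMr ?ltr0n ?fact_gt0//.
by apply: le_trans (expR_ge1Dxn i.+1 (ltW t0)); rewrite lerDr.
Qed.

Lemma is_derive_flat q x : is_derive x 1 (flat q) (flat (flat_deriv q) x).
Proof.
have [x0|x0|->] := ltgtP x 0.
- apply: (@near_eq_is_derive _ _ _ (cst 0)); last first.
    by rewrite /flat ltNge (ltW x0) /=; exact: is_derive_cst.
  near=> y; rewrite /flat ltNge ifF//; apply/negbF; rewrite ltW//.
  by near: y; exact: lt_nbhsl.
- apply: (@near_eq_is_derive _ _ _ (fun y : R => q.[y^-1] * expR (- y^-1) : R)).
    near=> y; rewrite /flat ifT//.
    by near: y; exact: lt_nbhsr.
  have xn0 : x != 0 by rewrite gt_eqF.
  have dV : is_derive x 1 (fun y : R => y^-1) (- x ^- 2).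
    apply: trigger_derive; first exact: (is_deriveV (f := id) xn0 (is_derive_id x 1)).
    by rewrite /GRing.scale /= mulr1.
  have dq : is_derive x 1 (fun y : R => q.[y^-1]) (q^`().[x^-1] * - x ^- 2).
    exact: (is_derive1_comp (f := horner q) (g := fun y => y^-1) (is_derive_poly q _) dV).
  have dE : is_derive x 1 (fun y : R => expR (- y^-1)) (expR (- x^-1) * x ^- 2).
    have := is_deriveN dV; rewrite opprK => dN.
    exact: (is_derive1_comp (f := @expR R) (g := fun y => - y^-1) (is_derive_expR _) dN).
  have dM := is_deriveM dq dE.
  apply: (trigger_derive dM).
  rewrite /flat x0 /flat_deriv hornerM hornerXn hornerD hornerN exprVn /GRing.scale/=.
  by ring.
(* At the origin the quadratic bound makes the difference quotient at most C |h|. *)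
have -> : flat (flat_deriv q) 0 = 0 by rewrite /flat ltxx.
have [C C0 hC] := flat_quadratic q.
suff cv : h^-1 *: ((flat q \o shift 0) h%:A - flat q 0) @[h --> 0^'] --> (0 : R).
  apply: DeriveDef; first by apply/cvg_ex; exists 0.
  by apply/cvg_lim.
apply/cvgr0Pnorm_lt => e e0.
near=> h.
have h0 : h != 0 by near: h; exact: nbhs_dnbhs_neq.
have f0 : flat q 0 = 0 by rewrite /flat ltxx.
rewrite f0 subr0 /= addr0 [_%:A]mulr1 normrZ normfV ltr_pdivrMl ?normr_gt0//.
apply: le_lt_trans (hC _) _.
rewrite -real_normK ?num_real// expr2 mulrA [ltRHS]mulrC ltr_pM2r ?normr_gt0//.
apply: (@le_lt_trans _ _ ((C + 1) * `|h|)).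
  by rewrite ler_wpM2r ?normr_ge0 ?lerDl.
rewrite mulrC -ltr_pdivlMr ?ltr_wpDl//.
near: h; apply: dnbhs0_lt; by rewrite divr_gt0 ?ltr_wpDl.
Unshelve. all: by end_near.
Qed.

Lemma flat_ge0 x : 0 <= flat 1 x.
Proof. by rewrite /flat; case: ifP => // _; rewrite hornerC mul1r expR_ge0. Qed.

Lemma flat_gt0 x : 0 < x -> 0 < flat 1 x.
Proof. by rewrite /flat => ->; rewrite hornerC mul1r expR_gt0. Qed.

Lemma flat_le0 q x : x <= 0 -> flat q x = 0.
Proof. by rewrite /flat leNgt; case: ifP. Qed.

Lemma flat_homo : {homo flat 1 : x y / x <= y}.
Proof.
move=> x y xy; have [x0|x0] := leP x 0; first by rewrite flat_le0// flat_ge0.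
have y0 := lt_le_trans x0 xy.
rewrite /flat x0 y0 !hornerC !mul1r ler_expR lerN2 lef_pV2//.
Qed.

End Flat.

(** * A syntactic class of smooth functions *)

Section Smooth.
Variable R : realType.
Implicit Types (f g : R * R -> R).

Lemma fst_continuous : continuous (fst : R * R -> R).
Proof. by move=> [x y]; exact: cvg_fst. Qed.

Lemma snd_continuous : continuous (snd : R * R -> R).
Proof. by move=> [x y]; exact: cvg_snd. Qed.

Lemma fst_differentiable (z : R * R) : differentiable (fst : R * R -> R) z.
Proof. exact: (linear_differentiable (f := fst) z fst_continuous). Qed.

Lemma snd_differentiable (z : R * R) : differentiable (snd : R * R -> R) z.
Proof. exact: (linear_differentiable (f := snd) z snd_continuous). Qed.

(** A class generated by explicit operations: differentiability, measurability and stability under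
    derivatives follow by induction, and it contains the polynomials and all cut-offs used below. *)
Inductive smooth : (R * R -> R) -> Prop :=
| smooth_cst c : smooth (fun=> c)
| smooth_fst : smooth fst
| smooth_snd : smooth snd
| smoothD f g : smooth f -> smooth g -> smooth (fun z => f z + g z)
| smoothM f g : smooth f -> smooth g -> smooth (fun z => f z * g z)
| smooth_flat q f : smooth f -> smooth (fun z => flat q (f z)).

Lemma smooth_differentiable f z : smooth f -> differentiable f z.
Proof.
move=> sf; elim: sf z => {f} [c|||f g _ df _ dg|f g _ df _ dg|q f _ df] z.
- exact: differentiable_cst.
- exact: fst_differentiable.
- exact: snd_differentiable.
- exact: differentiableD (df z) (dg z).
- exact: differentiableM (df z) (dg z).
- apply: (@differentiable_comp _ _ _ _ f (flat q)) => //.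
  apply/derivable1_diffP; exact: (@ex_derive _ _ _ _ _ _ _ (is_derive_flat q (f z))).
Qed.

Lemma smooth_continuous f : smooth f -> continuous f.
Proof. by move=> sf z; apply: differentiable_continuous; exact: smooth_differentiable. Qed.

(** Stability of the class under derivatives turns mere differentiability of its members into all
    orders of smoothness. *)
Lemma smooth_derive f v : smooth f -> smooth (fun z => 'D_v f z).
Proof.
elim=> {f} [c|||f g sf df sg dg|f g sf df sg dg|q f sf df].
- rewrite (_ : (fun z => _) = fun=> 0 : R); first exact: (smooth_cst _).
  by apply/funext => z; rewrite deriveE ?diff_val//; exact: differentiable_cst.
- rewrite (_ : (fun z => _) = fun=> v.1 : R); first exact: (smooth_cst _).
  by apply/funext => z; rewrite deriveE ?(diff_lin (f := fst) z fst_continuous)//; exact: fst_differentiable.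
- rewrite (_ : (fun z => _) = fun=> v.2 : R); first exact: (smooth_cst _).
  by apply/funext => z; rewrite deriveE ?(diff_lin (f := snd) z snd_continuous)//; exact: snd_differentiable.
- rewrite (_ : (fun z => _) = fun z => 'D_v f z + 'D_v g z); first exact: smoothD.
  apply/funext => z.
  by rewrite (deriveD (f := f) (g := g)) //; apply: diff_derivable; exact: smooth_differentiable.
- rewrite (_ : (fun z => _) = fun z => f z * 'D_v g z + g z * 'D_v f z).
    by apply: smoothD; exact: smoothM.
  apply/funext => z.
  by rewrite (deriveM (f := f) (g := g)) //; apply: diff_derivable; exact: smooth_differentiable.
- rewrite (_ : (fun z => _) = fun z => 'D_v f z * flat (flat_deriv q) (f z)).
    by apply: smoothM => //; exact: smooth_flat.
  apply/funext => z.
  have dfl : differentiable (flat q) (f z).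
    by apply/derivable1_diffP; exact: (@ex_derive _ _ _ _ _ _ _ (is_derive_flat q (f z))).
  have dfz := smooth_differentiable z sf.
  rewrite deriveE; last exact: (@differentiable_comp _ _ _ _ f (flat q)).
  rewrite (diff_comp (f := f) (g := flat q)) //=.
  have dZ (c : R) : 'd (flat q) (f z) c = c *: 'd (flat q) (f z) (1 : R).
    by rewrite -linearZ /= [c *: _]mulr1.
  rewrite dZ -!deriveE//.
  by rewrite (@derive_val _ _ _ _ _ _ _ (is_derive_flat q (f z))).
Qed.

Lemma smooth_Ck f k : smooth f -> Ck k f.
Proof.
elim: k f => [|k IH] f sf; split => //; try exact: smooth_continuous.
by split; try (by move=> x; apply: diff_derivable; exact: smooth_differentiable);
  apply: IH; exact: smooth_derive.
Qed.

End Smooth.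

(** * Integration in the plane *)

Section PlaneMeasure.
Variable R : realType.
Implicit Types (f g : R * R -> R).

(** An open set is the countable union of the open squares with rational centre and half-side that
    it contains. *)
Lemma open_plane_measurable (U : set (R * R)) : open U -> measurable U.
Proof.
move=> oU.
pose Q (p q r : rat) : set (R * R) :=
  `]ratr p - ratr r, ratr p + ratr r[ `*` `]ratr q - ratr r, ratr q + ratr r[.
have -> : U = \bigcup_p \bigcup_q \bigcup_r (if `[< Q p q r `<=` U >] then Q p q r else set0).
  apply/seteqP; split => [z Uz|z [p _ [q _ [r _]]]]; last by case: asboolP => // h /h.
  have /nbhs_ballP[e /= e0 he] : nbhs z U by rewrite nbhsE; exists U.
  have [r] := @rat_in_itvoo R 0 (e / 2) (divr_gt0 e0 (ltr0Sn _ _)).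
  rewrite in_itv /= => /andP[r0 re].
  have [p] := @rat_in_itvoo R (z.1 - ratr r) (z.1 + ratr r) ltac:(lra).
  rewrite in_itv /= => /andP[p1 p2].
  have [q] := @rat_in_itvoo R (z.2 - ratr r) (z.2 + ratr r) ltac:(lra).
  rewrite in_itv /= => /andP[q1 q2].
  exists p => //; exists q => //; exists r => //.
  rewrite asboolT; first by split; rewrite /= in_itv /=; lra.
  move=> w [/=]; rewrite !in_itv /= => /andP[w1 w2] /andP[w3 w4].
  apply: he; split; rewrite /ball /= ltr_norml; lra.
apply: bigcupT_measurable_rat => p; apply: bigcupT_measurable_rat => q.
apply: bigcupT_measurable_rat => r; case: asboolP => // _.
by apply: measurableX; exact: measurable_itv.
Qed.

Lemma smooth_measurable f : smooth f -> measurable_fun setT f.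
Proof.
elim => {f} [c|||f g _ mf _ mg|f g _ mf _ mg|q f _ mf].
- exact: measurable_cst.
- exact: measurable_fst.
- exact: measurable_snd.
- exact: measurable_funD mf mg.
- exact: measurable_funM mf mg.
- apply: (@measurableT_comp _ _ _ _ _ _ (flat q)) => //.
  apply: continuous_measurable_fun => x.
  apply/differentiable_continuous/derivable1_diffP.
  exact: (@ex_derive _ _ _ _ _ _ _ (is_derive_flat q x)).
Qed.

Lemma is_derive_line f (z v : R * R) (t : R) : smooth f ->
  is_derive t 1 (fun h => f (z + h *: v)) ('D_v f (z + t *: v)).
Proof.
move=> sf; set w := z + t *: v.
have E : (fun h : R => h^-1 *: (((fun h => f (z + h *: v)) \o shift t) (h *: 1) - f (z + t *: v)))
       = (fun h : R => h^-1 *: ((f \o shift w) (h *: v) - f w)).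
  apply/funext => h /=; congr (_ *: (f _ - _)).
  by rewrite [_%:A]mulr1 scalerDl addrCA addrC.
apply: DeriveDef.
- rewrite /derivable E; apply: diff_derivable; exact: smooth_differentiable.
- by rewrite /derive E.
Qed.

(** The complement of [A] is open, so [f] is zero near [z]. *)
Lemma derive_off_support f (A : set (R * R)) (v z : R * R) : closed A ->
  (forall w, ~ A w -> f w = 0) -> ~ A z -> 'D_v f z = 0.
Proof.
move=> cA f0 Az.
rewrite (_ : 0 = 'D_v (fun=> 0 : R) z); last first.
  by rewrite (@derive_val _ _ _ _ _ _ _ (is_derive_cst 0 z v)).
apply: near_eq_derive.
have : nbhs z (~` A) by rewrite nbhsE; exists (~` A) => //; split => //; exact: closed_openC.
by apply: filterS => w /f0.
Qed.

Lemma derive_integral_right (F F' : R -> R) (M c : R) :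
  (forall y : R, is_derive y 1 F (F' y)) -> continuous F' ->
  (forall y, M <= y -> F y = 0) -> (forall y, M <= y -> F' y = 0) ->
  (\int[lebesgue_measure]_(y in `]c, +oo[) (F' y)%:E = (- F c)%:E)%E.
Proof.
move=> dF cF' F0 F'0.
have cF : continuous F.
  by move=> y; apply/differentiable_continuous/derivable1_diffP; exact: ex_derive.
have mF' : measurable_fun setT F' by exact: continuous_measurable_fun.
rewrite integral_itv_obnd_cbnd; last first.
  by apply: measurable_funTS; exact/measurable_EFinP.
(* Beyond both [M] and [c]: the interval from [c] to [N] is nondegenerate, [F N] is 0, and nothing
   is lost past [N]. *)
pose N := Num.max M c + 1.
have [NM Nc] : M <= N /\ c < N by rewrite /N; split; case: (leP M c); lra.
rewrite (_ : (\int[_]_(y in _) _)%E = (\int[lebesgue_measure]_(y in `[c, N]) (F' y)%:E)%E).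
  rewrite (continuous_FTC2 (F := F)) //.
  - by rewrite F0// EFinN sub0e.
  - exact: continuous_subspaceT.
  - split; first by move=> x _; exact: ex_derive.
      exact: (cvg_at_right_filter (cF _)).
    exact: (cvg_at_left_filter (cF _)).
  - by move=> x _; rewrite derive1E derive_val.
rewrite integral_mkcond [RHS]integral_mkcond; apply: eq_integral => y _.
rewrite /patch !mem_setE !in_itv /= andbT; case: leP => //= cy.
by case: leP => // Ny; rewrite F'0// ltW// (le_lt_trans NM).
Qed.

Lemma derive_integral_left (F F' : R -> R) (M c : R) :
  (forall y : R, is_derive y 1 F (F' y)) -> continuous F' ->
  (forall y, y <= - M -> F y = 0) -> (forall y, y <= - M -> F' y = 0) ->
  (\int[lebesgue_measure]_(y in `]-oo, c]) (F' y)%:E = (F c)%:E)%E.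
Proof.
move=> dF cF' F0 F'0.
have cF : continuous F.
  by move=> y; apply/differentiable_continuous/derivable1_diffP; exact: ex_derive.
pose N := Num.min (- M) c - 1.
have [NM Nc] : N <= - M /\ N < c by rewrite /N; split; case: (leP (- M) c); lra.
rewrite (_ : (\int[_]_(y in _) _)%E = (\int[lebesgue_measure]_(y in `[N, c]) (F' y)%:E)%E).
  rewrite (continuous_FTC2 (F := F)) //.
  - by rewrite (F0 N)// sube0.
  - exact: continuous_subspaceT.
  - split; first by move=> x _; exact: ex_derive.
      exact: (cvg_at_right_filter (cF _)).
    exact: (cvg_at_left_filter (cF _)).
  - by move=> x _; rewrite derive1E derive_val.
rewrite integral_mkcond [RHS]integral_mkcond; apply: eq_integral => y _.
rewrite /patch !mem_setE !in_itv /= andbC; case: leP => //= cy.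
by case: leP => // Ny; rewrite F'0// ltW// (lt_le_trans Ny).
Qed.

End PlaneMeasure.

(** * Fubini, null sets and integrals over squares *)

Section PlaneIntegrals.
Variable R : realType.
Implicit Types (f g : R * R -> R) (x y m k r : R) (z : R * R) (sw : bool).

Local Notation mu := (@lebesgue_measure R).
Local Notation mu2 := (@lebesgue_measure R \x @lebesgue_measure R)%E.

(** Every line is a graph over one of the two axes; [sw] selects the axis, so vertical edges need no
    separate argument. *)
Definition swap_if sw x y : R * R := if sw then (y, x) else (x, y).

Lemma fubini_swap_if sw f : mu2.-integrable setT (EFin \o f) ->
  (\int[mu2]_z (f z)%:E = \int[mu]_x \int[mu]_y (f (swap_if sw x y))%:E)%E.
Proof.
move=> fi; case: sw.
- by rewrite -(integral21_prod_meas1 fi).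
- by rewrite -(integral12_prod_meas1 fi).
Qed.

(** Tonelli applied to the indicator function, in the order of integration given by [sw]. *)
Lemma null_by_sections sw (A : set (R * R)) : measurable A ->
  (forall x, mu [set y | A (swap_if sw x y)] = 0%E) -> mu2 A = 0%E.
Proof.
move=> mA A0.
have mi : measurable_fun setT (EFin \o (\1_A : R * R -> R)).
  exact/measurable_EFinP/measurable_indic.
have i0 w : (0 <= (EFin \o (\1_A : R * R -> R)) w)%E by rewrite lee_fin.
rewrite -[LHS](_ : \int[mu2]_z (\1_A z)%:E = _)%E; last first.
  by rewrite integral_indic// setIT.
have secE x : (\int[mu]_y (\1_A (swap_if sw x y))%:E = 0)%E.
  have mS : measurable [set y | A (swap_if sw x y)].
    case: sw {A0}.
    - rewrite (_ : mkset _ = ysection A x); first exact: measurable_ysection.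
      by apply/seteqP; split => y /=; rewrite ysectionE /= => /=; rewrite ?inE.
    - rewrite (_ : mkset _ = xsection A x); first exact: measurable_xsection.
      by apply/seteqP; split => y /=; rewrite xsectionE /= => /=; rewrite ?inE.
  rewrite -[RHS](A0 x) -[in RHS](setIT [set y | _]) -integral_indic//.
case: sw secE {A0} => secE.
- have := @fubini_tonelli2 _ _ _ _ R mu mu _ mi i0; move=> ->; apply: integral0_eq => x _; exact: secE.
- have := @fubini_tonelli1 _ _ _ _ R mu mu _ mi i0; move=> ->; apply: integral0_eq => x _; exact: secE.
Qed.

Definition box z r : set (R * R) := `[z.1 - r, z.1 + r] `*` `[z.2 - r, z.2 + r].

Lemma box_compact z r : compact (box z r).
Proof. by apply: compact_setX; exact: segment_compact. Qed.

Lemma box_closed z r : closed (box z r).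
Proof. by apply: compact_closed; [exact: norm_hausdorff|exact: box_compact]. Qed.

Lemma box_measurable z r : measurable (box z r).
Proof. by apply: measurableX; exact: measurable_itv. Qed.

Lemma box_finite z r : (mu2 (box z r) < +oo)%E.
Proof.
rewrite product_measure1E//= !lebesgue_measure_itv /=.
by case: ifP => _; case: ifP => _; rewrite ?mul0e ?mule0 ?ltry// -?EFinD -?EFinM ltry.
Qed.

Lemma continuous_box_bounded z r f : continuous f ->
  exists2 C, 0 <= C & forall w, box z r w -> `|f w| <= C.
Proof.
move=> cf.
have /compact_bounded[M [_ hM]] : compact (f @` box z r).
  apply: continuous_compact; last exact: box_compact.
  exact: continuous_subspaceT.
exists (`|M| + 1); first by rewrite addr_ge0.
move=> w bw; apply: (hM (`|M| + 1)); last by exists w.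
by rewrite ltr_pwDr// ler_norm.
Qed.

Lemma box_integrable z r f g : measurable_fun setT f -> continuous g ->
  (forall w, `|f w| <= g w) -> (forall w, ~ box z r w -> f w = 0) ->
  mu2.-integrable setT (EFin \o f).
Proof.
move=> mf cg fg f0.
have [C C0 hC] := continuous_box_bounded z r cg.
rewrite (_ : EFin \o f = (EFin \o f) \_ (box z r)); last first.
  apply/funext => w; rewrite /patch; case: ifPn => // /negP; rewrite inE => /f0 /= ->//.
have := @integrable_mkcond _ _ R mu2 (box z r) (EFin \o f) (box_measurable z r); move=> [+ _]; apply.
apply: measurable_bounded_integrable; [exact: box_measurable|exact: box_finite|exact: measurable_funTS|].
exists C; split; first exact: num_real.
move=> M CM w bw /=; apply: le_trans (ltW CM).
by apply: le_trans (hC w bw); rewrite (le_trans (fg w))// ler_norm.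
Qed.

Lemma integral_box z r (U : set (R * R)) f : box z r `<=` U ->
  (forall w, ~ box z r w -> f w = 0) ->
  (\int[mu2]_(w in U) (f w)%:E = \int[mu2]_(w in box z r) (f w)%:E)%E.
Proof.
move=> bU f0; rewrite integral_mkcond [RHS]integral_mkcond.
apply: eq_integral => w _; rewrite /patch.
have [bw|nbw] := pselect (box z r w).
  by rewrite !mem_set//; exact: bU.
by rewrite (f0 _ nbw) !if_same.
Qed.

End PlaneIntegrals.

(** * Integration by parts across a line *)

Section Jump.
Variable R : realType.
Implicit Types (f g : R * R -> R) (x y m k r : R) (z : R * R) (sw : bool).

Local Notation mu := (@lebesgue_measure R).
Local Notation mu2 := (@lebesgue_measure R \x @lebesgue_measure R)%E.

(** The axis direction transversal to a graph over the other axis; the derivative in this direction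
    alone detects a jump. *)
Definition dir_if sw : R * R := swap_if sw 0 1.

(* Signed height of z above the line y = m * x + k of the swapped plane. *)
Definition height sw m k z : R :=
  (if sw then z.1 - m * z.2 else z.2 - m * z.1) - k.

Lemma smooth_neg f : smooth f -> smooth (fun z => - f z).
Proof.
move=> sf; rewrite (_ : (fun z => _) = fun z => (-1) * f z).
  by apply: smoothM => //; exact: (smooth_cst (-1)).
by apply/funext => z; rewrite mulN1r.
Qed.

Lemma smoothB f g : smooth f -> smooth g -> smooth (fun z => f z - g z).
Proof. by move=> sf sg; apply: smoothD => //; exact: smooth_neg. Qed.

Lemma smooth_height sw m k : smooth (height sw m k).
Proof.
rewrite /height; apply: smoothB; last exact: smooth_cst.
case: sw; apply: smoothB; try (apply: smoothM; first exact: smooth_cst);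
  first [exact: smooth_fst | exact: smooth_snd].
Qed.

Lemma is_derive_swap_if sw f x y : smooth f ->
  is_derive y 1 (fun t => f (swap_if sw x t)) ('D_(dir_if sw) f (swap_if sw x y)).
Proof.
move=> sf; have := is_derive_line (swap_if sw x 0) (dir_if sw) y sf.
have E t : swap_if sw x 0 + t *: dir_if sw = swap_if sw x t.
  rewrite /dir_if /swap_if; case: sw; apply: injective_projections => /=;
  by rewrite ?scaler0 ?[_%:A]mulr1 ?add0r ?addr0.
by rewrite E; under eq_fun do rewrite E.
Qed.

Lemma swap_if_continuous sw (h : R -> R) : continuous h ->
  continuous (fun x => swap_if sw x (h x)).
Proof.
move=> ch x; case: sw.
- exact: (cvg_pair (ch x) (@cvg_id _ (nbhs x))).
- exact: (cvg_pair (@cvg_id _ (nbhs x)) (ch x)).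
Qed.

Lemma swap_if_line_continuous sw x : continuous (swap_if sw x).
Proof.
move=> y; case: sw.
- exact: (cvg_pair (@cvg_id _ (nbhs y)) (cvg_cst x)).
- exact: (cvg_pair (cvg_cst x) (@cvg_id _ (nbhs y))).
Qed.

(** On the line itself the value is that of [g]; the line is a null set, so this choice is
    harmless. *)
Definition split_fun sw m k f g z : R := if 0 < height sw m k z then f z else g z.

Lemma split_fun_measurable sw m k f g :
  smooth f -> smooth g -> measurable_fun setT (split_fun sw m k f g).
Proof.
move=> sf sg; apply: measurable_fun_ifT; last 2 first.
- exact: smooth_measurable.
- exact: smooth_measurable.
apply: measurable_fun_ltr; first exact: measurable_cst.
by apply: smooth_measurable; exact: smooth_height.
Qed.

Lemma split_fun_le sw m k f g z : `|split_fun sw m k f g z| <= `|f z| + `|g z|.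
Proof. by rewrite /split_fun; case: ifP; rewrite ?lerDl ?lerDr. Qed.

(* Fubini and the fundamental theorem of calculus on each side of the line. *)
Lemma integral_split_fun_derive sw m k z0 r f g : smooth f -> smooth g ->
  (forall w, ~ box z0 r w -> f w = 0) -> (forall w, ~ box z0 r w -> g w = 0) ->
  (\int[mu2]_z (split_fun sw m k ('D_(dir_if sw) f) ('D_(dir_if sw) g) z)%:E =
   \int[mu]_x (g (swap_if sw x (m * x + k)) - f (swap_if sw x (m * x + k)))%:E)%E.
Proof.
move=> sf sg f0 g0.
have df0 w : ~ box z0 r w -> 'D_(dir_if sw) f w = 0.
  by apply: derive_off_support => //; exact: box_closed.
have dg0 w : ~ box z0 r w -> 'D_(dir_if sw) g w = 0.
  by apply: derive_off_support => //; exact: box_closed.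
have sdf := smooth_derive (dir_if sw) sf.
have sdg := smooth_derive (dir_if sw) sg.
rewrite (fubini_swap_if sw); last first.
  apply: (@box_integrable _ z0 r _
    (fun z => `|'D_(dir_if sw) f z| + `|'D_(dir_if sw) g z|)).
  - exact: split_fun_measurable.
  - move=> w; apply: cvgD; apply: cvg_norm.
      exact: (smooth_continuous sdf).
    exact: (smooth_continuous sdg).
  - exact: split_fun_le.
  - by move=> w bw; rewrite /split_fun df0// dg0// if_same.
apply: eq_integral => x _.
set c := m * x + k.
have hE y : height sw m k (swap_if sw x y) = y - c.
  by rewrite /height /c; case: sw {sf sg f0 g0 df0 dg0 sdf sdg} => /=; ring.
(* Outside the range from [- M] to [M] the transversal line over [x] has left the box. *)
have [M hM] : exists M, forall y, (M <= y \/ y <= - M) -> ~ box z0 r (swap_if sw x y).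
  exists (`|z0.1| + `|z0.2| + r + 1) => y.
  have := ler_norm z0.1; have := ler_norm z0.2.
  have := ler_norm (- z0.1); have := ler_norm (- z0.2); rewrite !normrN => n1 n2 n3 n4.
  move=> h; rewrite /box /= !in_itv /=.
  have := normr_ge0 z0.1; have := normr_ge0 z0.2 => p1 p2.
  by case: (sw) => /= -[/andP[? ?] /andP[? ?]]; case: h => ?; lra.
have mm : measurable_fun setT (fun y => (split_fun sw m k ('D_(dir_if sw) f) ('D_(dir_if sw) g) (swap_if sw x y))%:E).
  apply/measurable_EFinP; apply: measurableT_comp; first exact: split_fun_measurable.
  by case: (sw); apply: measurable_fun_pair => //; exact: measurable_cst.
rewrite (_ : setT = `]-oo, c] `|` `]c, +oo[); last first.
  by apply/seteqP; split => // y _ /=; rewrite !in_itv /= andbT; case: (leP y c); [left|right].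
rewrite integral_setU//; [|exact: measurable_funTS|]; last first.
  apply/disj_setPLR => y /=; rewrite !in_itv /= andbT => yc.
  by apply/negP; rewrite -leNgt.
have cD h : smooth h -> continuous (fun y => 'D_(dir_if sw) h (swap_if sw x y)).
  move=> sh y.
  apply: (@cvg_comp _ _ _ (swap_if sw x) ('D_(dir_if sw) h) _ (nbhs (swap_if sw x y))).
    exact: swap_if_line_continuous.
  exact: (smooth_continuous (smooth_derive (dir_if sw) sh)).
(* On each half-line the integrand is the derivative of a function that vanishes far away; only the
   boundary terms at [c] remain, with opposite signs. *)
have Il : (\int[mu]_(y in `]-oo, c]) ('D_(dir_if sw) g (swap_if sw x y))%:E =
    (g (swap_if sw x c))%:E)%E.
  apply: (@derive_integral_left _ (fun y => g (swap_if sw x y)) _ M).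
  - by move=> y; exact: is_derive_swap_if.
  - exact: cD.
  - by move=> y My; apply: g0; apply: hM; right.
  - by move=> y My; apply: dg0; apply: hM; right.
have Ir : (\int[mu]_(y in `]c, +oo[) ('D_(dir_if sw) f (swap_if sw x y))%:E =
    (- f (swap_if sw x c))%:E)%E.
  apply: (@derive_integral_right _ (fun y => f (swap_if sw x y)) _ M).
  - by move=> y; exact: is_derive_swap_if.
  - exact: cD.
  - by move=> y My; apply: f0; apply: hM; left.
  - by move=> y My; apply: df0; apply: hM; left.
rewrite EFinB -EFinN -Il -Ir; congr (_ + _)%E; apply: eq_integral => y;
  rewrite inE /= in_itv /= => yc; rewrite /split_fun hE subr_gt0.
- by rewrite ltNge yc.
- by move: yc; rewrite andbT => ->.
Qed.

(** A positive value at [x0] would keep [w] above half of it on an interval, and the integral would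
    be positive. *)
Lemma continuous_integral_eq0 (w : R -> R) x0 : continuous w -> (forall x, 0 <= w x) ->
  (\int[mu]_x (w x)%:E = 0)%E -> w x0 = 0.
Proof.
move=> cw w0 iw; apply/eqP; rewrite eq_le w0 andbT leNgt; apply/negP => wx0.
have : \forall x \near x0, w x0 / 2 < w x.
  by apply: (cvgr_gt _ (cw x0)); lra.
move=> /nbhs_ballP[e /= e0 he].
have mw : measurable_fun setT (EFin \o w).
  by apply/measurable_EFinP; exact: continuous_measurable_fun.
suff : (0 < \int[mu]_x (w x)%:E)%E by rewrite iw ltxx.
pose I := [set` `]x0 - e, x0 + e[].
have mI : measurable I by exact: measurable_itv.
apply: (@lt_le_trans _ _ (\int[mu]_(x in I) (cst (w x0 / 2)%:E x))%E).
  rewrite integral_cst// [X in (_ * X)%E](_ : _ = (2 * e)%:E).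
    by rewrite -EFinM lte_fin mulr_gt0//; lra.
  apply: etrans (lebesgue_measure_itv _) _.
  by rewrite /= lte_fin ifT; [rewrite -EFinD; congr EFin; ring|lra].
apply: (@le_trans _ _ (\int[mu]_(x in I) (w x)%:E)%E).
  apply: ge0_le_integral => //.
  - by move=> x _; rewrite lee_fin; lra.
  - by apply: measurable_funTS.
  - move=> x; rewrite /I /= in_itv /= => /andP[x1 x2]; rewrite lee_fin ltW//; apply: he.
    by rewrite /ball /= ltr_norml; lra.
by apply: ge0_subset_integral => // x _; rewrite lee_fin.
Qed.

End Jump.

(** * Absence of jumps *)

Section TestFunctions.
Variable R : realType.
Implicit Types (f g : R * R -> R) (x y m k r : R) (z : R * R) (sw : bool).

Local Notation mu := (@lebesgue_measure R).
Local Notation mu2 := (@lebesgue_measure R \x @lebesgue_measure R)%E.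

(** A product over the coordinates, so that the support lies in a square [box] rather than a
    disc. *)
Definition plane_bump z0 r z : R :=
  flat 1 (r ^+ 2 - (z.1 - z0.1) ^+ 2) * flat 1 (r ^+ 2 - (z.2 - z0.2) ^+ 2).

Lemma smooth_sqr f : smooth f -> smooth (fun z => f z ^+ 2).
Proof. by move=> sf; under eq_fun do rewrite expr2; exact: smoothM. Qed.

Lemma smooth_plane_bump z0 r : smooth (plane_bump z0 r).
Proof.
apply: smoothM; apply: smooth_flat; (apply: smoothB; first exact: smooth_cst);
  apply: smooth_sqr; (apply: smoothB; last exact: smooth_cst);
  first [exact: smooth_fst | exact: smooth_snd].
Qed.

Lemma plane_bump_ge0 z0 r z : 0 <= plane_bump z0 r z.
Proof. by rewrite mulr_ge0 ?flat_ge0. Qed.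

Lemma plane_bump_gt0 z0 r : 0 < r -> 0 < plane_bump z0 r z0.
Proof. by move=> r0; rewrite /plane_bump !subrr expr0n subr0 mulr_gt0// flat_gt0// exprn_gt0. Qed.

Lemma plane_bump_off_box z0 r z : 0 < r -> ~ box z0 r z -> plane_bump z0 r z = 0.
Proof.
move=> r0; rewrite /box /= !in_itv /= => nb.
have far t : ~ (- r <= t <= r) -> flat 1 (r ^+ 2 - t ^+ 2) = 0.
  move=> nt; apply: flat_le0; rewrite subr_le0 leNgt; apply/negP => h; apply: nt.
  by rewrite -ler_norml -(ler_pXn2r (n := 2)) ?nnegrE ?(ltW r0)// -normrX ger0_norm ?sqr_ge0// ltW.
apply/eqP; rewrite mulf_eq0; apply/orP.
have [h1|h1] := boolP (- r <= z.1 - z0.1 <= r); last by left; apply/eqP/far/negP.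
have [h2|h2] := boolP (- r <= z.2 - z0.2 <= r); last by right; apply/eqP/far/negP.
by exfalso; apply: nb; move/andP: h1 => [? ?]; move/andP: h2 => [? ?]; split; apply/andP; split; lra.
Qed.

(** The cut-off c_n of the overview: for n > 0 it vanishes where the height is at least n^(-1/2) in
    absolute value. The factor [(flat 1 1)^-1] normalises it to 1 on the line. *)
Definition squeeze sw m k (n : nat) z : R :=
  (flat 1 1)^-1 * flat 1 (1 - n%:R * height sw m k z ^+ 2).

Lemma smooth_squeeze sw m k n : smooth (squeeze sw m k n).
Proof.
apply: smoothM; first exact: smooth_cst.
apply: smooth_flat; apply: smoothB; first exact: smooth_cst.
by apply: smoothM; [exact: smooth_cst|apply: smooth_sqr; exact: smooth_height].
Qed.

Lemma squeeze_on_line sw m k n z : height sw m k z = 0 -> squeeze sw m k n z = 1.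
Proof.
by move=> hz; rewrite /squeeze hz expr0n mulr0 subr0 mulVf// gt_eqF// flat_gt0.
Qed.

Lemma squeeze_norm_le1 sw m k n z : `|squeeze sw m k n z| <= 1.
Proof.
have f1 : 0 < flat 1 (1 : R) by rewrite flat_gt0.
rewrite ger0_norm; last by rewrite mulr_ge0 ?invr_ge0 ?(ltW f1) ?flat_ge0.
rewrite ler_pdivrMl// mulr1; apply: flat_homo.
by rewrite lerBlDr lerDl mulr_ge0 ?sqr_ge0.
Qed.

Lemma squeeze_eventually0 sw m k z : height sw m k z != 0 ->
  \forall n \near \oo, squeeze sw m k n z = 0.
Proof.
move=> hz; have h2 : 0 < height sw m k z ^+ 2 by rewrite exprn_even_gt0.
near=> n; rewrite /squeeze [X in _ * X]flat_le0 ?mulr0// subr_le0 -ler_pdivrMr// div1r.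
by near: n; exact: nbhs_infty_ger.
Unshelve. all: by end_near. Qed.

Lemma height_null sw m k : mu2 [set z | height sw m k z = 0] = 0%E.
Proof.
apply: (null_by_sections (sw := sw)).
  rewrite (_ : mkset _ = height sw m k @^-1` [set 0])//.
  rewrite -[X in measurable X]setTI; apply: smooth_measurable => //.
  exact: smooth_height.
move=> x; rewrite (_ : mkset _ = [set m * x + k]); first exact: lebesgue_measure_set1.
apply/seteqP; split => y /=; case: sw; rewrite /height /=; move=> h; lra.
Qed.

Lemma test_function_box (U : set (R * R)) z0 r f : smooth f -> box z0 r `<=` U ->
  (forall w, ~ box z0 r w -> f w = 0) -> test_function U f.
Proof.
move=> sf bU f0; split; first by move=> n; exact: smooth_Ck.
have cl : closure [set x | f x != 0] `<=` box z0 r.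
  rewrite [X in _ `<=` X](_ : _ = closure (box z0 r)); last exact/closure_id/box_closed.
  by apply: closure_subset => w /= fw; apply: contrapT => /f0 /eqP; rewrite (negbTE fw).
split; last exact: subset_trans cl bU.
by apply: subclosed_compact cl; [exact: closed_closure|exact: box_compact].
Qed.

End TestFunctions.

(** * A square-integrable weak derivative excludes jumps *)

Section JumpLemma.
Variable R : realType.
Implicit Types (f g : R * R -> R) (x y m k r : R) (z : R * R) (sw : bool).

Local Notation mu := (@lebesgue_measure R).
Local Notation mu2 := (@lebesgue_measure R \x @lebesgue_measure R)%E.

(** The transversal weak derivative suffices. The trace term on the line is independent of the width
    of the strip, whereas the plane integrals tend to 0 with it. *)
Lemma weak_derivative_no_jump (U : set (R * R)) sw m k f g (d : R * R -> R) z0 :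
  open U -> U z0 -> height sw m k z0 = 0 -> smooth f -> smooth g ->
  L2 U d -> weak_derivative U (dir_if R sw) (split_fun sw m k f g) d -> f z0 = g z0.
Proof.
move=> oU Uz0 hz0 sf sg [md id2] wd.
have mU := open_plane_measurable oU.
have [r r0 bU] : exists2 r, 0 < r & box z0 r `<=` U.
  have /nbhs_ballP[e /= e0 he] : nbhs z0 U by rewrite nbhsE; exists U.
  exists (e / 2); first lra.
  move=> w [/=]; rewrite !in_itv /= => /andP[? ?] /andP[? ?].
  by apply: he; split; rewrite /ball /= ltr_norml; lra.
set A := box z0 r in bU *.
have mA : measurable A := box_measurable z0 r.
(* The jump itself is a factor of the test function, so the trace integrand [w] is a square times a
   bump, hence nonnegative. *)
pose psi z := (g z - f z) * plane_bump z0 r z.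
have spsi : smooth psi by apply: smoothM; [exact: smoothB|exact: smooth_plane_bump].
pose phi n z := psi z * squeeze sw m k n z.
have sphi n : smooth (phi n) by apply: smoothM => //; exact: smooth_squeeze.
have phi0 n w : ~ A w -> phi n w = 0.
  by move=> Aw; rewrite /phi /psi plane_bump_off_box// mulr0 mul0r.
set v := dir_if R sw.
have sD h : smooth h -> smooth ('D_v h) by exact: smooth_derive.
have Dphi0 n w : ~ A w -> 'D_v (phi n) w = 0.
  by apply: derive_off_support; [exact: box_closed|exact: phi0].
pose df := split_fun sw m k ('D_v f) ('D_v g).
have mdf : measurable_fun setT df by apply: split_fun_measurable; exact: sD.
pose w x := (g (swap_if sw x (m * x + k)) - f (swap_if sw x (m * x + k))) *
            psi (swap_if sw x (m * x + k)).
have dprod h n : smooth h ->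
    'D_v (fun z => h z * phi n z) = fun z => h z * 'D_v (phi n) z + phi n z * 'D_v h z.
  move=> sh; apply/funext => z.
  by rewrite (deriveM (f := h) (g := phi n))//; apply: diff_derivable; exact: smooth_differentiable.
(* By the product rule the integrand is the derivative of [f * phi n] above the line and of
   [g * phi n] below; on the line [squeeze] is 1, so [n] disappears. *)
have jump n : (\int[mu2]_z (split_fun sw m k f g z * 'D_v (phi n) z + df z * phi n z)%:E =
    \int[mu]_x (w x)%:E)%E.
  have lz x : height sw m k (swap_if sw x (m * x + k)) = 0.
    by rewrite /height; case: (sw) => /=; ring.
  apply: etrans (etrans (@integral_split_fun_derive _ sw m k z0 r (fun z => f z * phi n z)
    (fun z => g z * phi n z) (smoothM sf (sphi n)) (smoothM sg (sphi n)) _ _) _).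
  - apply: eq_integral => z _; congr EFin; rewrite !dprod// /df /split_fun.
    by case: ifP => _; congr (_ + _); rewrite mulrC.
  - by move=> z Az; rewrite phi0// mulr0.
  - by move=> z Az; rewrite phi0// mulr0.
  - apply: eq_integral => x _; congr EFin.
    by rewrite -mulrBl /w /phi squeeze_on_line// mulr1.
(* The summand 1 lets the same constant bound [psi] alone as well as its products with the
   derivatives. *)
have [C C0 hC] : exists2 C, 0 <= C & forall z, A z ->
    `|(`|'D_v f z| + `|'D_v g z| + 1) * psi z| <= C.
  apply: continuous_box_bounded => z; apply: cvgM; last exact: (smooth_continuous spsi).
  apply: cvgD; last exact: cvg_cst.
  apply: cvgD; apply: cvg_norm.
    exact: (smooth_continuous (sD _ sf)).
  exact: (smooth_continuous (sD _ sg)).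
have mdA : measurable_fun A d by exact: measurable_funS md.
have id2A : mu2.-integrable A (fun z => (d z ^+ 2)%:E) by exact: integrableS id2.
(* Only the square of [d] is known to be integrable; 1 + |d| <= 2 + d^2 and the finite measure of
   the box give an integrable majorant. *)
pose G z := C * (2 + d z ^+ 2).
have iG : mu2.-integrable A (EFin \o G).
  rewrite (_ : EFin \o G = fun z => (C%:E * ((cst 2%:E \+ (fun z => (d z ^+ 2)%:E)) z))%E)//.
  apply: integrableZl => //; apply: integrableD => //.
  apply: measurable_bounded_integrable => //; first exact: box_finite.
  by exists 2; split => // M M2 z _ /=; rewrite ger0_norm// ltW.
have phi_le n z : `|phi n z| <= `|psi z|.
  by rewrite /phi normrM ler_piMr// squeeze_norm_le1.
have dphi_le n z : A z -> `|d z * phi n z| <= G z.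
  move=> Az; rewrite normrM; apply: (@le_trans _ _ (`|d z| * C)).
    apply: ler_wpM2l => //; apply: le_trans (phi_le n z) _.
    apply: le_trans (hC z Az); rewrite [leRHS]normrM ler_peMl//.
    by rewrite ger0_norm ?addr_ge0// lerDr addr_ge0.
  rewrite /G mulrC ler_wpM2l// -real_normK ?num_real//.
  by have := sqr_ge0 (`|d z| - 1); nra.
have tot_le n z : A z -> `|df z * phi n z - d z * phi n z| <= G z.
  move=> Az; rewrite -mulrBl normrM.
  apply: (@le_trans _ _ ((`|'D_v f z| + `|'D_v g z| + 1) * `|psi z| * (1 + `|d z|))).
    rewrite mulrAC; apply: ler_pM => //.
    apply: le_trans (ler_normB _ _) _.
    have := split_fun_le sw m k ('D_v f) ('D_v g) z.
    have := normr_ge0 ('D_v f z); have := normr_ge0 ('D_v g z); have := normr_ge0 (d z).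
    rewrite -/df; nra.
  have := hC z Az; rewrite normrM ger0_norm ?addr_ge0// => h.
  apply: (@le_trans _ _ (C * (1 + `|d z|))); first by rewrite ler_wpM2r ?addr_ge0.
  rewrite /G ler_wpM2l// -[d z ^+ 2]real_normK ?num_real//.
  by have := sqr_ge0 (`|d z| - 1); nra.
have mphi n : measurable_fun setT (phi n) by exact: smooth_measurable.
have msf : measurable_fun setT (split_fun sw m k f g) by exact: split_fun_measurable.
have idphi n : mu2.-integrable A (EFin \o (fun z => d z * phi n z)).
  apply: le_integrable iG => //.
    apply/measurable_EFinP; apply: measurable_funM => //; exact: (measurable_funTS (mphi n)).
  move=> z Az; rewrite /= lee_fin; apply: le_trans (dphi_le n z Az) _; exact: ler_norm.
have i1 n : mu2.-integrable setT (EFin \o (fun z => split_fun sw m k f g z * 'D_v (phi n) z)).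
  apply: (@box_integrable _ z0 r _ (fun z => (`|f z| + `|g z|) * `|'D_v (phi n) z|)).
  - by apply: measurable_funM => //; apply: smooth_measurable; exact: sD.
  - move=> z; apply: cvgM; last by apply: cvg_norm; exact: (smooth_continuous (sD _ (sphi n))).
    by apply: cvgD; apply: cvg_norm; [exact: (smooth_continuous sf)|exact: (smooth_continuous sg)].
  - by move=> z; rewrite normrM ler_wpM2r// split_fun_le.
  - by move=> z Az; rewrite Dphi0// mulr0.
have i2 n : mu2.-integrable setT (EFin \o (fun z => df z * phi n z)).
  apply: (@box_integrable _ z0 r _ (fun z => (`|'D_v f z| + `|'D_v g z|) * `|phi n z|)).
  - exact: measurable_funM.
  - move=> z; apply: cvgM; last by apply: cvg_norm; exact: (smooth_continuous (sphi n)).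
    by apply: cvgD; apply: cvg_norm; [exact: (smooth_continuous (sD _ sf))|exact: (smooth_continuous (sD _ sg))].
  - by move=> z; rewrite normrM ler_wpM2r// split_fun_le.
  - by move=> z Az; rewrite phi0// mulr0.
have toA (h : R * R -> R) : mu2.-integrable setT (EFin \o h) -> mu2.-integrable A (EFin \o h).
  by apply: integrableS.
(* The weak derivative identity replaces the term with ['D_v (phi n)] by minus the integral of
   [d * phi n]; the supports reduce all domains to [A]. *)
have IE n : (\int[mu]_x (w x)%:E = \int[mu2]_(z in A) (df z * phi n z - d z * phi n z)%:E)%E.
  rewrite -(jump n) (integral_box (z := z0) (r := r) (U := setT)) => //; last first.
    by move=> z Az; rewrite phi0// Dphi0// !mulr0 addr0.
  rewrite (@integralD_EFin _ _ R mu2 A mA _ _ (toA _ (i1 n)) (toA _ (i2 n))).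
  have := wd (phi n) (test_function_box (sphi n) bU (@phi0 n)).
  rewrite (integral_box bU); last by move=> z Az; rewrite Dphi0// mulr0.
  rewrite (integral_box (f := fun z => d z * phi n z) bU); last by move=> z Az; rewrite phi0// mulr0.
  rewrite /= => ->.
  by rewrite addeC -(@integralB_EFin _ _ R mu2 A _ _ mA (toA _ (i2 n)) (idphi n)).
have mtot n : measurable_fun A (fun z => (df z * phi n z - d z * phi n z)%:E).
  apply/measurable_EFinP; apply: measurable_funB.
    by apply: measurable_funM; exact: measurable_funTS.
  by apply: measurable_funM => //; exact: (measurable_funTS (mphi n)).
(* Off the null line each point eventually leaves the shrinking strip. *)
have aecvg : {ae mu2, forall z, A z ->
    (df z * phi n z - d z * phi n z)%:E @[n --> \oo] --> (cst 0%E : R * R -> \bar R) z}.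
  exists [set z | height sw m k z = 0]; split; [|exact: height_null|].
    rewrite (_ : mkset _ = height sw m k @^-1` [set 0])//.
    by rewrite -[X in measurable X]setTI; apply: smooth_measurable => //; exact: smooth_height.
  move=> z /= nc; apply: contrapT => hz; apply: nc => _.
  apply: cvg_near_cst; near=> n.
  rewrite /phi (_ : squeeze sw m k n z = 0) ?mulr0 ?subrr//.
  by near: n; apply: squeeze_eventually0; exact/eqP.
have aele : {ae mu2, forall z n, A z -> (`|(df z * phi n z - d z * phi n z)%:E| <= (EFin \o G) z)%E}.
  by apply: aeW => z n Az; rewrite /= lee_fin; exact: tot_le.
have m0 : measurable_fun A (cst 0%E : R * R -> \bar R) by exact: measurable_cst.
have [_ _ lim0] := @dominated_convergence _ _ R mu2 A mA
  (fun n z => (df z * phi n z - d z * phi n z)%:E) _ (EFin \o G) mtot m0 aecvg iG aele.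
have Iw : (\int[mu]_x (w x)%:E = 0)%E.
  (* The sequence of integrals is constant and tends to 0. *)
  move: lim0; rewrite integral0.
  rewrite (_ : (fun n => _) = cst (\int[mu]_x (w x)%:E)%E); last first.
    by apply/funext => n; rewrite (IE n).
  by move=> h; apply: (cvg_unique _ (@cvg_cst _ _ _ _ _) h) => //; exact: ereal_hausdorff.
have wE x : w x = (g (swap_if sw x (m * x + k)) - f (swap_if sw x (m * x + k))) ^+ 2 *
     plane_bump z0 r (swap_if sw x (m * x + k)).
  by rewrite /w /psi mulrA expr2.
(* The parameter at which the graph passes through [z0]. *)
pose x0 := if sw then z0.2 else z0.1.
have z0E : swap_if sw x0 (m * x0 + k) = z0.
  rewrite /x0; move: hz0; rewrite /height; case: (sw) => /= h;
    apply: injective_projections => //=; lra.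
have cl : continuous (fun x => swap_if sw x (m * x + k)).
  apply: swap_if_continuous => x; apply: cvgD; last exact: cvg_cst.
  by apply: cvgM; [exact: cvg_cst|exact: cvg_id].
have cw : continuous w.
  have sw2 : smooth (fun z => (g z - f z) * psi z) by apply: smoothM => //; exact: smoothB.
  move=> x; apply: (@cvg_comp _ _ _ (fun x => swap_if sw x (m * x + k))
    (fun z => (g z - f z) * psi z) _ (nbhs (swap_if sw x (m * x + k)))).
    exact: cl.
  exact: (smooth_continuous sw2).
have w0 x : 0 <= w x by rewrite wE mulr_ge0 ?sqr_ge0 ?plane_bump_ge0.
have := continuous_integral_eq0 x0 cw w0 Iw; rewrite wE z0E => /eqP.
rewrite mulf_eq0 (gt_eqF (plane_bump_gt0 z0 r0)) orbF sqrf_eq0 subr_eq0 => /eqP ->//.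
Unshelve. all: by end_near. Qed.

End JumpLemma.

(** * Convex quadrilaterals *)

Section Quadrilaterals.
Variable R : realType.
Implicit Types (a b c d z : R * R) (K : set (R * R)).

Lemma orientC a b c : orient b c a = orient a b c.
Proof. by rewrite /orient; ring. Qed.

Lemma orient_swap a b z : orient b a z = - orient a b z.
Proof. by rewrite /orient; ring. Qed.

Lemma orient_continuous a b : continuous (orient a b).
Proof.
apply: smooth_continuous; apply: smoothB; (apply: smoothM; first exact: smooth_cst);
  apply: smoothB; first [exact: smooth_cst | exact: smooth_fst | exact: smooth_snd].
Qed.

Lemma orient_comb a b (x y : R * R) (s t : R) : s + t = 1 ->
  orient a b (s *: x + t *: y) = s * orient a b x + t * orient a b y.
Proof.
move=> st; have -> : s = 1 - t by lra.
by rewrite /orient /= /GRing.scale /=; ring.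
Qed.

Lemma orient_edge a b : orient a b a = 0 /\ orient a b b = 0.
Proof. by rewrite /orient; split; ring. Qed.

Lemma hull4_rot a b c d : hull4 a b c d = hull4 b c d a.
Proof.
suff sub (x y z w : R * R) : hull4 x y z w `<=` hull4 y z w x.
  by apply/seteqP; split=> [|]; [exact: sub|do 3 apply: subset_trans (sub _ _ _ _) _].
move=> p [s [t [u [v [[s0 t0 u0 v0] [st ->]]]]]].
exists t, u, v, s; split; first by split.
by split; [rewrite -st; ring|rewrite -!addrA addrC -!addrA].
Qed.

(** [orient a b] is affine and vanishes at [a] and [b], so only the weights of [c] and [d]
    contribute, with positive coefficients; value 0 forces both weights to be 0. *)
Lemma hull4_orient a b c d z : 0 < orient a b c -> 0 < orient d a b ->
  hull4 a b c d z ->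
  0 <= orient a b z /\ (orient a b z = 0 -> segment a b z).
Proof.
move=> o1 o2 [s [t [u [v [[s0 t0 u0 v0] [st zE]]]]]].
have oE : orient a b z = u * orient a b c + v * orient d a b.
  rewrite zE /orient /= /GRing.scale /=; have -> : s = 1 - t - u - v by lra.
  by ring.
have uo : 0 <= u * orient a b c by rewrite mulr_ge0// ltW.
have vo : 0 <= v * orient d a b by rewrite mulr_ge0// ltW.
split; first by rewrite oE addr_ge0.
rewrite oE => /eqP; rewrite paddr_eq0// !mulf_eq0 (gt_eqF o1) (gt_eqF o2) !orbF.
move=> /andP[/eqP u1 /eqP v1]; exists t; first by rewrite /= in_itv /=; lra.
rewrite zE u1 v1 !scale0r !addr0; congr (_ *: _ + _); lra.
Qed.

(** The diagonal [c a] cuts the cell into two triangles; in the one on the side of [z], ratios of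
    areas are barycentric coordinates. *)
Lemma orient_hull4 a b c d z : 0 < orient a b c -> 0 < orient c d a ->
  0 <= orient a b z -> 0 <= orient b c z -> 0 <= orient c d z -> 0 <= orient d a z ->
  hull4 a b c d z.
Proof.
move=> o1 o2 h1 h2 h3 h4; have [h|h] := leP 0 (orient c a z).
- exists (orient b c z / orient a b c), (orient c a z / orient a b c),
    (orient a b z / orient a b c), 0.
  have n1 := lt0r_neq0 o1; split; first by split=> //; rewrite divr_ge0// ltW.
  split; first by move: n1; rewrite /orient => n1; field.
  by apply: injective_projections; rewrite /= /GRing.scale /=; move: n1; rewrite /orient => n1; field.
- exists (orient c d z / orient c d a), 0, (orient d a z / orient c d a),
    (- orient c a z / orient c d a).
  have n2 := lt0r_neq0 o2; split; first by split=> //; rewrite divr_ge0// ltW// oppr_gt0.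
  split; first by move: n2; rewrite /orient => n2; field.
  by apply: injective_projections; rewrite /= /GRing.scale /=; move: n2; rewrite /orient => n2; field.
Qed.

Lemma quad_rot K a b c d : quad_with_vertices K a b c d -> quad_with_vertices K b c d a.
Proof. by move=> [[? ? ? ?] ->]; split => //; exact: hull4_rot. Qed.

(** The cell as an intersection of four half-planes, the form used for interiors, closedness and
    intersections; rotation reduces the four edges to the first. *)
Lemma quadP K a b c d z : quad_with_vertices K a b c d ->
  K z <-> [/\ 0 <= orient a b z, 0 <= orient b c z, 0 <= orient c d z & 0 <= orient d a z].
Proof.
move=> q; split; last first.
  by move: q => [[? ? ? ?] ->] [? ? ? ?]; exact: orient_hull4.
have first_edge x y u v : quad_with_vertices K x y u v -> K z -> 0 <= orient x y z.
  by move=> [[? ? ? ?] ->] /hull4_orient[].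
by move=> Kz; split; apply: first_edge Kz;
  [exact: q|exact: quad_rot q|exact: (quad_rot (quad_rot q))|exact: (quad_rot (quad_rot (quad_rot q)))].
Qed.

Lemma quad_on_edge K a b c d z : quad_with_vertices K a b c d ->
  K z -> orient a b z = 0 -> segment a b z.
Proof. by move=> [[? ? ? ?] ->] /hull4_orient[]. Qed.

Lemma segment_sub_quad K a b c d : quad_with_vertices K a b c d -> segment a b `<=` K.
Proof.
move=> [_ ->] z [t /=]; rewrite in_itv /= => /andP[t0 t1] <-.
exists (1 - t), t, 0, 0; split; first by split => //; lra.
by split; [ring|rewrite !scale0r !addr0].
Qed.

Lemma segment_orient a b z : segment a b z -> orient a b z = 0.
Proof.
move=> [t _ <-]; rewrite orient_comb ?subrK//.
by have [-> ->] := orient_edge a b; rewrite !mulr0 addr0.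
Qed.

Lemma segmentC a b : segment a b = segment b a.
Proof.
suff sub (x y : R * R) : segment x y `<=` segment y x by apply/seteqP; split; exact: sub.
move=> z [t /=]; rewrite in_itv /= => /andP[t0 t1] <-.
exists (1 - t); first by rewrite /= in_itv /=; lra.
by rewrite addrC; congr (_ + _ *: _); ring.
Qed.

Lemma quad_vertices_neq K a b c d : quad_with_vertices K a b c d -> a <> b.
Proof. by move=> [[+ _ _ _] _] ab; rewrite ab /orient !subrr !mul0r subrr ltxx. Qed.

(* Moving from z in the direction a - c decreases orient a b. *)
Lemma quad_interior_gt0 K a b c d z : quad_with_vertices K a b c d ->
  K° z -> 0 < orient a b z.
Proof.
move=> q Kz; have o1 : 0 < orient a b c by case: q => -[].
have [oge _ _ _] := (quadP z q).1 (interior_subset Kz).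
rewrite lt_neqAle oge andbT; apply/eqP => oz.
pose line (t : R) : R * R := z + t *: (a - c).
have cl : continuous line.
  move=> t; apply: cvgD; [exact: cvg_cst|apply: cvgZl; exact: cvg_id].
have : \forall t \near (0 : R), K (line t).
  by apply: cl; rewrite /line scale0r addr0.
move=> /nbhs_ballP[e /= e0 he].
have /he : ball (0 : R) e (e / 2).
  by rewrite /ball /= sub0r normrN gtr0_norm; lra.
move=> /(quadP _ q)[+ _ _ _]; apply/negP; rewrite -ltNge.
have -> : orient a b (line (e / 2)) = orient a b z - e / 2 * orient a b c.
  by rewrite /line /orient /= /GRing.scale /=; ring.
rewrite -oz sub0r oppr_lt0 mulr_gt0//; lra.
Qed.

Lemma quad_gt0_interior K a b c d z : quad_with_vertices K a b c d ->
  0 < orient a b z -> 0 < orient b c z -> 0 < orient c d z -> 0 < orient d a z -> K° z.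
Proof.
move=> q h1 h2 h3 h4; rewrite /interior /=.
near=> w; apply/(quadP _ q); split; apply: ltW; near: w;
  by apply: (cvgr_gt _ (@orient_continuous _ _ _)).
Unshelve. all: by end_near. Qed.

Lemma quad_closed K a b c d : quad_with_vertices K a b c d -> closed K.
Proof.
move=> q.
have -> : K = [set z | 0 <= orient a b z] `&` [set z | 0 <= orient b c z] `&`
             [set z | 0 <= orient c d z] `&` [set z | 0 <= orient d a z].
  apply/seteqP; split => z; first by move/(quadP z q) => [].
  by move=> [[[? ?] ?] ?]; apply/(quadP z q).
have cl (x y : R * R) : closed [set z | 0 <= orient x y z].
  have cxy : continuous (orient x y) by exact: orient_continuous.
  exact: ((continuous_closedP _).1 cxy _ (@closed_ge _ 0)).
by repeat apply: closedI => //.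
Qed.

(** A cell is closed, and a point of it with four positive orientations is interior; so some
    orientation vanishes at a boundary point. *)
Lemma boundary_edges K a b c d z : quad_with_vertices K a b c d -> boundary K z ->
  [\/ segment a b z, segment b c z, segment c d z | segment d a z].
Proof.
move=> q [+ nKz]; rewrite -(closure_id _).1; last exact: quad_closed q.
move=> Kz; have [h1 h2 h3 h4] := (quadP z q).1 Kz.
have q1 := quad_rot q; have q2 := quad_rot q1; have q3 := quad_rot q2.
have [e1|n1] := eqVneq (orient a b z) 0; first by constructor 1; exact: quad_on_edge q Kz e1.
have [e2|n2] := eqVneq (orient b c z) 0; first by constructor 2; exact: quad_on_edge q1 Kz e2.
have [e3|n3] := eqVneq (orient c d z) 0; first by constructor 3; exact: quad_on_edge q2 Kz e3.
have [e4|n4] := eqVneq (orient d a z) 0; first by constructor 4; exact: quad_on_edge q3 Kz e4.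
by case: nKz; apply: (quad_gt0_interior q); rewrite lt_neqAle eq_sym; apply/andP.
Qed.

End Quadrilaterals.

(** * Polynomials and dual bases *)

Section Polynomials.
Variable R : realType.
Implicit Types (p : {poly {poly R}}) (a e : R * R).

Lemma pevalMXaddC p c z : peval (p * 'X + c%:P) z = peval p z * z.1 + c.[z.2].
Proof. by rewrite /peval !hornerE. Qed.

Lemma peval_smooth p : smooth (peval p).
Proof.
elim/poly_ind: p => [|p c IH].
  rewrite (_ : peval 0 = fun=> 0); first exact: (smooth_cst 0).
  by apply/funext => z; rewrite /peval !horner0.
rewrite (_ : peval _ = fun z => peval p z * z.1 + c.[z.2]); last first.
  by apply/funext => z; rewrite pevalMXaddC.
apply: smoothD; first by apply: smoothM => //; exact: smooth_fst.
elim/poly_ind: c => [|c u IHc].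
  by under eq_fun do rewrite horner0; exact: (smooth_cst 0).
under eq_fun do rewrite hornerMXaddC.
by apply: smoothD; [apply: smoothM => //; exact: smooth_snd|exact: smooth_cst].
Qed.

(** Reduces identities on a line to one variable, where vanishing on an interval spreads to the
    whole line. *)
Lemma peval_line p a e : exists L : {poly R}, forall t, peval p (a + t *: e) = L.[t].
Proof.
elim/poly_ind: p => [|p c [L IH]].
  by exists 0 => t; rewrite /peval !horner0.
exists (L * (a.1%:P + e.1 *: 'X) + (c \Po (a.2%:P + e.2 *: 'X))) => t.
rewrite pevalMXaddC IH hornerD hornerM horner_comp !hornerE /=.
by congr (_ * (_ + _) + c.[_ + _]); rewrite [LHS]mulrC.
Qed.

Lemma poly_eq0_interval (L : {poly R}) (x y : R) : x < y ->
  (forall t, x < t < y -> L.[t] = 0) -> L = 0.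
Proof.
move=> xy L0; apply/eqP; apply: contraT => Ln0.
(* Distinct points of the open interval, since 1/(i+2) lies strictly between 0 and 1; [size L] of
   them are too many roots for a nonzero [L]. *)
pose f (i : nat) : R := x + (y - x) / i.+2%:R.
have finj : injective f.
  move=> i j /addrI /mulfI; rewrite subr_eq0 (gt_eqF xy) => /(_ isT) /invr_inj /eqP.
  by rewrite eqr_nat => /eqP [].
have := max_poly_roots (rs := map f (iota 0 (size L))) Ln0.
rewrite size_map size_iota ltnn map_inj_uniq// iota_uniq => /(_ _ isT) -> //.
apply/allP => _ /mapP[i _ ->]; apply/rootP/L0; rewrite /f ltrDl divr_gt0 ?subr_gt0//=.
rewrite -ltrBrDl ltr_pdivrMr// ltr_pMr ?subr_gt0// ltr1n//.
Qed.

End Polynomials.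

(** * Prescribing the values of a dual basis *)

Section DualBasis.
Variable R : realType.
Implicit Types (P : set {poly {poly R}}) (l : {poly {poly R}} -> R).

Definition closed_comb P := forall (c : R) p q, P p -> P q -> P (c%:P *: p + q).

Lemma findim_closed P : findim_space P -> P 0 /\ closed_comb P.
Proof.
move=> [m [b ->]]; split.
  by exists (fun=> 0); rewrite big1// => i _; rewrite scale0r.
move=> c p q [cp ->] [cq ->]; exists (fun i => c * cp i + cq i).
rewrite scaler_sumr -big_split; apply: eq_bigr => i _ /=.
by rewrite polyCD polyCM scalerDl scalerA.
Qed.

Lemma linear_on0 P l : P 0 -> linear_on P l -> l 0 = 0.
Proof.
move=> P0 ll; have := ll 1 0 0 P0 P0; rewrite scaler0 addr0 mul1r.
by move=> /esym/eqP; rewrite -subr_eq0 addrK => /eqP.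
Qed.

Lemma linear_on_sum P l (m : nat) (c : 'I_m -> R) (b : 'I_m -> {poly {poly R}}) :
  P 0 -> closed_comb P -> linear_on P l -> (forall i, P (b i)) ->
  P (\sum_i (c i)%:P *: b i) /\ l (\sum_i (c i)%:P *: b i) = \sum_i c i * l (b i).
Proof.
move=> P0 Pc ll Pb; elim: (index_enum _) => [|i s [Ps IH]].
  by rewrite !big_nil; split => //; exact: linear_on0 ll.
by rewrite !big_cons; split; [exact: Pc|rewrite ll// IH].
Qed.

(** Let [A] hold the values of the functionals on a spanning family. Independence of the functionals
    makes its columns independent, so its rows span everything and [r] is a combination of them. *)
Lemma dual_basis_interpolation P (m : nat) (N : 'I_m -> {poly {poly R}} -> R) (r : 'I_m -> R) :
  findim_space P -> dual_basis P N -> exists2 q, P q & forall i, N i q = r i.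
Proof.
move=> fP [Nlin Nfree _]; have [P0 Pc] := findim_closed fP.
move: fP => [m0 [b PE]].
have Pb j : P (b j).
  rewrite PE; exists (fun k => (k == j)%:R); rewrite (bigD1 j)//= eqxx scale1r big1 ?addr0//.
  by move=> k /negbTE ->; rewrite scale0r.
have Nsum i c := linear_on_sum c P0 Pc (Nlin i) Pb.
pose A : 'M[R]_(m0, m) := \matrix_(j, i) N i (b j).
have fullA : row_full A.
  suff : row_free A^T by rewrite /row_free /row_full mxrank_tr.
  apply: inj_row_free => v vA.
  apply/rowP => i; rewrite mxE; apply: (Nfree (v 0)) => p.
  rewrite PE => -[c ->]; under eq_bigr do rewrite (Nsum _ c).2 mulr_sumr.
  rewrite exchange_big big1//= => j _.
  have /rowP/(_ j) := vA; rewrite !mxE => vAj.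
  rewrite -[RHS](mulr0 (c j)) -[in RHS]vAj mulr_sumr; apply: eq_bigr => k _.
  by rewrite !mxE mulrCA.
have /submxP[D rD] := submx_full (\row_i r i) fullA.
exists (\sum_j (D 0 j)%:P *: b j); first by rewrite PE; exists (D 0).
move=> i; rewrite (Nsum i _).2; have /rowP/(_ i) := rD; rewrite !mxE => ->.
by apply: eq_bigr => j _; rewrite mxE.
Qed.

End DualBasis.

(** * Two cells on opposite sides of an edge *)

Section NeighbouringCells.
Variable R : realType.
Implicit Types (a b c d z : R * R) (K : set (R * R)).

(** Vertical lines are taken as graphs over the second axis, all others over the first. The sign of
    [r] tells whether the left side of [a b] is above or below the graph. *)
Lemma orient_height a b : a <> b ->
  exists sw m k r, r != 0 /\ forall z, orient a b z = r * height sw m k z.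
Proof.
move=> ab; have [e|ne] := eqVneq (b.1 - a.1) 0.
  exists true, 0, a.1, (a.2 - b.2); split.
    rewrite subr_eq0; apply/eqP => e2; apply: ab.
    by apply: injective_projections => //; lra.
  by move=> z; rewrite /orient /height e; ring.
exists false, ((b.2 - a.2) / (b.1 - a.1)), (a.2 - (b.2 - a.2) / (b.1 - a.1) * a.1), (b.1 - a.1).
by split => // z; rewrite /orient /height; field.
Qed.

(** The two cells run through the common edge in opposite directions and so lie on opposite sides of
    its line; here [c] separates them. *)
Lemma neighbours_neq K K' a b c d c' d' :
  quad_with_vertices K a b c d -> quad_with_vertices K' b a c' d' -> K <> K'.
Proof.
move=> q q' KK'; have o1 : 0 < orient a b c by case: q => -[].
have Kc : K c.
  apply: (segment_sub_quad (quad_rot q)); exists 1; first by rewrite /= in_itv /=; lra.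
  by rewrite subrr scale0r add0r scale1r.
by rewrite KK' in Kc; have [+ _ _ _] := (quadP c q').1 Kc; rewrite orient_swap; lra.
Qed.

Lemma neighbours_meet K K' a b c d c' d' :
  quad_with_vertices K a b c d -> quad_with_vertices K' b a c' d' -> K `&` K' = segment a b.
Proof.
move=> q q'; apply/seteqP; split=> [z [Kz K'z]|z abz].
  apply: (quad_on_edge q Kz); have [h _ _ _] := (quadP z q).1 Kz.
  by have [+ _ _ _] := (quadP z q').1 K'z; rewrite orient_swap; lra.
by split; [exact: segment_sub_quad q _ abz|apply: (segment_sub_quad q'); rewrite segmentC].
Qed.

Lemma neighbours_grid K K' a b c d c' d' :
  quad_with_vertices K a b c d -> quad_with_vertices K' b a c' d' -> grid [set K; K'].
Proof.
move=> q q'; split; first exact: finite_set2.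
  by move=> X [->|->]; [exists a, b, c, d|exists b, a, c', d'].
have eK : is_edge K (segment a b) by exists a, b, c, d.
have eK' : is_edge K' (segment a b) by exists b, a, c', d'; rewrite segmentC.
have KK' := neighbours_meet q q'.
by move=> X Y [->|->] [->|->] // _ _; right; exists (segment a b); rewrite // setIC.
Qed.

(** A point inside the edge satisfies the six other side conditions strictly, so they persist
    nearby; the sign of [orient a b] then decides which cell contains a nearby point. *)
Lemma neighbours_domain K K' a b c d c' d' (t : R) :
  quad_with_vertices K a b c d -> quad_with_vertices K' b a c' d' -> 0 < t < 1 ->
  grid_domain [set K; K'] (a + t *: (b - a)).
Proof.
move=> q q' /andP[t0 t1].
have zE : a + t *: (b - a) = (1 - t) *: a + t *: b.
  by rewrite scalerBr scalerBl scale1r addrA addrAC.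
set z := a + t *: (b - a) in zE *.
have oz x y : orient x y z = (1 - t) * orient x y a + t * orient x y b.
  by rewrite zE orient_comb// subrK.
(* An affine function nonnegative at both ends of the edge and positive at one of them is positive
   in between. *)
have pos (x y : R * R) : 0 <= orient x y a -> 0 <= orient x y b ->
    0 < orient x y a \/ 0 < orient x y b -> 0 < orient x y z.
  by rewrite oz; nra.
have e0 (x y : R * R) : orient x y x = 0 /\ orient x y y = 0 by exact: orient_edge.
move: (q) => [[u1 u2 u3 u4] _]; move: (q') => [[p1 p2 p3 p4] _].
have h1 : 0 < orient b c z.
  by apply: pos; rewrite ?(orientC a b c) ?(e0 b c).1 ?(ltW u1)//; left.
have h2 : 0 < orient c d z.
  by apply: pos; rewrite ?(orientC b c d) ?(ltW u3) ?(ltW u2)//; left.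
have h3 : 0 < orient d a z.
  by apply: pos; rewrite ?(e0 d a).2 ?(ltW u4)//; right.
have h1' : 0 < orient a c' z.
  by apply: pos; rewrite ?(orientC b a c') ?(e0 a c').1 ?(ltW p1)//; right.
have h2' : 0 < orient c' d' z.
  by apply: pos; rewrite ?(orientC a c' d') ?(ltW p3) ?(ltW p2)//; right.
have h3' : 0 < orient d' b z.
  by apply: pos; rewrite ?(e0 d' b).2 ?(ltW p4)//; left.
rewrite /grid_domain /interior /=.
near=> w.
have [h|h] := leP 0 (orient a b w).
- exists K; [by left|apply/(quadP _ q); split => //; apply: ltW; near: w;
    by apply: (cvgr_gt _ (@orient_continuous _ _ _ _))].
- exists K'; [by right|apply/(quadP _ q'); split; first by rewrite orient_swap; lra].
  all: by apply: ltW; near: w; apply: (cvgr_gt _ (@orient_continuous _ _ _ _)).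
Unshelve. all: by end_near. Qed.

End NeighbouringCells.

(** * Conforming families of elements *)

Section ConformingFamily.
Variable R : realType.
Variables (F : set (R * R) -> element R) (common : identification F).
Hypothesis F_ciarlet : forall K : set (R * R), convex_quad K -> ciarlet_element K (F K).
Hypothesis common_coherent : coherent common.
Hypothesis F_conforming : forall J : set (set (R * R)), grid J ->
  fe_space common J `<=` H1 (grid_domain J).
Implicit Types (a b c d z : R * R) (K : set (R * R)) (p q : {poly {poly R}}).

(** Agreement of the common parameters puts the piecewise function made of [p] and [q] in the space
    on the two-cell grid, hence in H1, where it cannot jump. *)
Lemma common_values_traces_agree K K' a b c d c' d' p q :
  quad_with_vertices K a b c d -> quad_with_vertices K' b a c' d' ->
  poly_space (F K) p -> poly_space (F K') q ->
  (forall i j, common i j -> nodal_param (i : 'I_(nnodes (F K))) p =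
                             nodal_param (j : 'I_(nnodes (F K'))) q) ->
  forall t, 0 < t < 1 -> peval p (a + t *: (b - a)) = peval q (a + t *: (b - a)).
Proof.
move=> qK qK' Pp Pq pq t t01.
have gJ := neighbours_grid qK qK'.
have nKK' := neighbours_neq qK qK'.
set z := a + t *: (b - a).
have Uz : grid_domain [set K; K'] z := neighbours_domain qK qK' t01.
have [cc1 cc2 _ _ _] := common_coherent gJ.
pose pp X := if `[< X = K >] then p else q.
have ppK : pp K = p by rewrite /pp asboolT.
have ppK' : pp K' = q by rewrite /pp asboolF// => /esym.
(* Membership depends only on the values off the line [a b], because each open cell lies strictly on
   one side. *)
have inF v : measurable_fun setT v -> (forall w, 0 < orient a b w -> v w = peval p w) ->
    (forall w, orient a b w < 0 -> v w = peval q w) -> fe_space common [set K; K'] v.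
  move=> mv vp vq; split; first exact: measurable_funTS.
  exists pp; split.
    move=> X [->|->]; rewrite ?ppK ?ppK'; split => // w wX.
    - by apply: vp; exact: quad_interior_gt0 qK wX.
    - by apply: vq; have := quad_interior_gt0 qK' wX; rewrite orient_swap oppr_gt0.
  move=> X Y i j [|] /= XE [|] /= YE; subst X Y; rewrite ?ppK ?ppK'.
  - by move=> /cc1 -> //; left.
  - exact: pq.
  - by move=> /cc2 h; apply/esym/pq/h; [right|left].
  - by move=> /cc1 -> //; right.
have [sw [m [k [r [r0 orE]]]]] := orient_height (quad_vertices_neq qK).
have hz : height sw m k z = 0.
  have : orient a b z = 0 by rewrite /z /orient /= /GRing.scale /=; ring.
  by rewrite orE => /eqP; rewrite mulf_eq0 (negbTE r0) => /eqP.
have oU : open (grid_domain [set K; K']) by exact: open_interior.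
have nojump f g : smooth f -> smooth g ->
    fe_space common [set K; K'] (split_fun sw m k f g) -> f z = g z.
  move=> sf sg /(F_conforming gJ)[_ [d1 [d2 [L1 L2' w1 w2]]]].
  by case: (sw) hz w1 w2 => hz w1 w2;
    [exact: weak_derivative_no_jump oU Uz hz sf sg L1 w1|
     exact: weak_derivative_no_jump oU Uz hz sf sg L2' w2].
have sp := peval_smooth p; have sq := peval_smooth q.
(* The sign of [r] decides which of [p] and [q] is the piece above the graph. *)
have [rlt|rgt|req] := ltgtP r 0; last by rewrite req eqxx in r0.
- apply/esym/nojump => //; apply: inF; first exact: split_fun_measurable.
  + by move=> w; rewrite orE nmulr_rgt0// /split_fun => hw; rewrite ltNge (ltW hw).
  + by move=> w; rewrite orE nmulr_rlt0// /split_fun => ->.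
- apply: nojump => //; apply: inF; first exact: split_fun_measurable.
  + by move=> w; rewrite orE pmulr_rgt0// /split_fun => ->.
  + by move=> w; rewrite orE pmulr_rlt0// /split_fun => hw; rewrite ltNge (ltW hw).
Qed.

Lemma interpolate_nodal_params K (r : 'I_(nnodes (F K)) -> R) : convex_quad K ->
  exists2 q, poly_space (F K) q & forall i, nodal_param i q = r i.
Proof. by move=> /F_ciarlet[fP dB _]; exact: dual_basis_interpolation. Qed.

Lemma nodal_param0 K (i : 'I_(nnodes (F K))) : convex_quad K ->
  nodal_param i 0 = 0.
Proof.
move=> /F_ciarlet[fP [lin _ _] _]; have [P0 _] := findim_closed fP.
exact: linear_on0 P0 (lin i).
Qed.

Lemma poly_space0 K : convex_quad K -> poly_space (F K) 0.
Proof. by move=> /F_ciarlet[fP _ _]; have [] := findim_closed fP. Qed.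

Lemma common_site K K' (i : 'I_(nnodes (F K))) (j : 'I_(nnodes (F K'))) J :
  grid J -> J K -> J K' -> K <> K' -> common i j ->
  exists s, [/\ shareable s, site_of K s, site_of K' s, node_site i = s & node_site j = s].
Proof.
move=> gJ JK JK' KK' ij; have [_ _ _ cc _] := common_coherent gJ.
have [sh ssE] := cc _ _ _ _ JK JK' KK' ij.
have [_ cq _] := gJ.
have [_ _ sK] := F_ciarlet (cq _ JK); have [_ _ sK'] := F_ciarlet (cq _ JK').
by exists (node_site i); split => //; rewrite ssE.
Qed.

(** A vertex or an edge of a cell is a nonempty part of it, so cells without a common point have no
    common site. *)
Lemma site_inhabited s (K K' K'' : set (R * R)) : shareable s ->
  site_of K s -> site_of K' s -> site_of K'' s -> K `&` K' `&` K'' !=set0.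
Proof.
have vertex_in (X : set (R * R)) x : is_vertex X x -> X x.
  move=> [b [c [d q]]]; apply: (segment_sub_quad q); exists 0; first by rewrite /= in_itv /=; lra.
  by rewrite subr0 scale1r scale0r addr0.
have edge_sub (X e : set (R * R)) : is_edge X e -> e `<=` X /\ e !=set0.
  move=> [a [b [c [d [q ->]]]]]; split; first exact: segment_sub_quad q.
  exists a; exists 0; first by rewrite /= in_itv /=; lra.
  by rewrite subr0 scale1r scale0r addr0.
case: s => [x|e|] sh /=; last by case: sh.
- by move=> /vertex_in h1 /vertex_in h2 /vertex_in h3; exists x.
- by move=> /edge_sub[h1 [x ex]] /edge_sub[h2 _] /edge_sub[h3 _]; exists x;
    split; [split; [exact: h1|exact: h2]|exact: h3].
Qed.

(* The nodal parameters shared by K and K' belong to the edge a b, hence are not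
   attached to K'': extended by 0 to K'', q stays in the finite element space. *)
Lemma neighbour_extension K K' K'' a b c d c' d' e f p :
  quad_with_vertices K a b c d -> quad_with_vertices K' b a c' d' ->
  quad_with_vertices K'' d' c' e f -> K `&` K' `&` K'' = set0 ->
  poly_space (F K) p ->
  exists q, (forall t, 0 < t < 1 -> peval p (a + t *: (b - a)) = peval q (a + t *: (b - a))) /\
            (forall t, 0 < t < 1 -> peval q (c' + t *: (d' - c')) = 0).
Proof.
move=> qK qK' qK'' K0 Pp.
have qK'2 := quad_rot (quad_rot qK').
have cK' : convex_quad K' by exists b, a, c', d'.
have cK'' : convex_quad K'' by exists d', c', e, f.
have gJ := neighbours_grid qK qK'; have gJ' := neighbours_grid qK'2 qK''.
have nKK' := neighbours_neq qK qK'; have nKK'' := neighbours_neq qK'2 qK''.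
have [cc1 cc2 cc3 _ _] := common_coherent gJ.
(* Parameters with a counterpart in [K] receive its value at [p]; all others receive 0. *)
pose r (j : 'I_(nnodes (F K'))) : R :=
  if pselect (exists i : 'I_(nnodes (F K)), common i j) is left h
  then nodal_param (projT1 (cid h)) p else 0.
(* The chosen counterpart is the only one: by symmetry and transitivity two of them are identified
   within [K], hence equal. *)
have rE i j : common i j -> r j = nodal_param (i : 'I_(nnodes (F K))) p.
  move=> ij; rewrite /r; case: pselect => [h|[]]; last by exists i.
  case: cid => i' i'j /=; congr (nodal_param _ p).
  have JK : [set K; K'] K by left. have JK' : [set K; K'] K' by right.
  by apply: (cc1 _ _ _ JK).1; apply: (cc3 _ _ _ _ _ _ JK JK' JK i'j); exact: cc2.
have [q Pq qr] := interpolate_nodal_params r cK'.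
exists q; split.
- apply: (common_values_traces_agree qK qK' Pp Pq) => i j ij.
  by rewrite qr (rE _ _ ij).
- move=> t t01.
  (* [q] on [K'] is compared with 0 on [K'']. *)
  rewrite (common_values_traces_agree qK'2 qK'' Pq (poly_space0 cK'') _ t01).
    by rewrite /peval !horner0.
  move=> j k jk; rewrite (nodal_param0 k cK'') qr /r.
  (* A nonzero value would need a counterpart in [K]; the site would then belong to all three cells,
     which have no common point. *)
  case: pselect => // h; case: (cid h) => i ij /=; exfalso.
  have [s [sh s1 s2 _ js]] := common_site gJ (or_introl erefl) (or_intror erefl) nKK' ij.
  have [s' [_ _ s3 js' _]] := common_site gJ' (or_introl erefl) (or_intror erefl) nKK'' jk.
  rewrite -js' js in s3.
  by have := site_inhabited sh s1 s2 s3; rewrite K0 => -[x].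
Qed.

Lemma vanish_on_edge K a b c d p : quad_with_vertices K a b c d ->
  poly_space (F K) p -> forall t, peval p (a + t *: (b - a)) = 0.
Proof.
move=> qK Pp.
have [L LE] := peval_line p a (b - a).
(* It is enough to treat parameters between 1 and 2, that is, points of the line beyond [b]: they
   are infinitely many roots of [L]. *)
suff L0 : L = 0 by move=> t; rewrite LE L0 horner0.
apply: (@poly_eq0_interval _ _ 1 2); first lra.
move=> tau /andP[tau1 tau2]; rewrite -LE.
(* Chosen so that the line through [c'] and [d'] meets the line [a b] at parameter [tau]: the offset
   1 - tau (1 - lam) is 0 there. As tau > 1, [lam] lies between 0 and 1. *)
pose lam := 1 - tau^-1.
have tau0 : 0 < tau by lra.
have lam0 : 0 < lam by rewrite /lam subr_gt0 invf_lt1.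
have lam1 : lam < 1 by rewrite /lam ltrBlDr ltrDl invr_gt0.
(* [b - a] turned left by a right angle, towards [K]; subtracting it crosses the edge. [N] is the
   squared length. *)
pose n : R * R := (- (b.2 - a.2), b.1 - a.1).
pose c' := a - n; pose d' := b - lam *: n.
pose N := (b.1 - a.1) ^+ 2 + (b.2 - a.2) ^+ 2.
have N0 : 0 < N.
  rewrite lt_neqAle addr_ge0 ?sqr_ge0// andbT eq_sym paddr_eq0 ?sqr_ge0// !sqrf_eq0.
  apply/negP => /andP[/eqP e1 /eqP e2]; apply: (quad_vertices_neq qK).
  by apply: injective_projections; lra.
have oE x y z v : orient x y z = v * N -> 0 < v -> 0 < orient x y z.
  by move=> -> v0; rewrite mulr_gt0.
(* [K'] is the trapezoid across [a b], and [K''] a parallelogram beyond its opposite edge. *)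
pose K' := hull4 b a c' d'; pose K'' := hull4 d' c' (c' - n) (d' - n).
have qK' : quad_with_vertices K' b a c' d'.
  split => //; split; [apply: (oE _ _ _ 1)|apply: (oE _ _ _ 1)|apply: (oE _ _ _ lam)|apply: (oE _ _ _ lam)] => //;
  by rewrite /c' /d' /n /N /orient /= /GRing.scale /=; ring.
have qK'' : quad_with_vertices K'' d' c' (c' - n) (d' - n).
  split => //; split; apply: (oE _ _ _ 1) => //;
  by rewrite /c' /d' /n /N /orient /= /GRing.scale /=; ring.
(* A common point would lie on both [a b] and [c' d'], but [orient a b] is negative along
   [c' d']. *)
have K0 : K `&` K' `&` K'' = set0.
  apply/seteqP; split => // z [Kz K''z].
  have K'z : K' z by case: Kz.
  have : segment a b z by rewrite -(neighbours_meet qK qK').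
  have : segment c' d' z.
    by rewrite -(neighbours_meet (quad_rot (quad_rot qK')) qK'').
  move=> [s /=]; rewrite in_itv /= => /andP[s0 s1] zE /segment_orient.
  rewrite -zE orient_comb ?subrK// => h.
  have oc : orient a b c' = - N by rewrite /c' /n /N /orient /=; ring.
  have od : orient a b d' = - (lam * N) by rewrite /d' /n /N /orient /= /GRing.scale /=; ring.
  have hs : s * (1 - lam) <= 1 - lam by rewrite ler_piMl//; lra.
  have : 0 < N * (1 - s * (1 - lam)) by rewrite mulr_gt0//; lra.
  by move: h; rewrite oc od; lra.
have [q [pq q0]] := neighbour_extension qK qK' qK'' K0 Pp.
have [M ME] := peval_line q a (b - a).
have [S SE] := peval_line q c' (d' - c').
have S0 : S = 0.
  by apply: (@poly_eq0_interval _ _ 0 1); [lra|move=> t t01; rewrite -SE q0].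
(* [p] and [q] agree on the open edge, hence on its whole line, in particular at [tau]. *)
have LM : L - M = 0.
  apply: (@poly_eq0_interval _ _ 0 1); first lra.
  by move=> t t01; rewrite hornerD hornerN -LE -ME pq// subrr.
have -> : peval p (a + tau *: (b - a)) = peval q (a + tau *: (b - a)).
  by rewrite LE ME; move/eqP: LM; rewrite subr_eq0 => /eqP ->.
(* The two lines reach their meeting point at the same parameter [tau], and [q] vanishes on the
   second. *)
have -> : a + tau *: (b - a) = c' + tau *: (d' - c').
  have tn : tau != 0 by rewrite gt_eqF.
  by apply: injective_projections; rewrite /c' /d' /n /lam /= /GRing.scale /=; field.
by rewrite SE S0 horner0.
Qed.

Lemma vanish_on_segment K a b c d p z : quad_with_vertices K a b c d ->
  poly_space (F K) p -> segment a b z -> peval p z = 0.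
Proof.
move=> qK Pp [t _ <-]; rewrite -(vanish_on_edge qK Pp t).
by rewrite scalerBr scalerBl scale1r addrA addrAC.
Qed.

End ConformingFamily.

Theorem theorem3 (R : realType) (F : set (R * R) -> element R)
    (common : identification F)
    (hF : forall K : set (R * R), convex_quad K -> ciarlet_element K (F K))
    (hcommon : coherent common)
    (hH1 : forall J : set (set (R * R)), grid J ->
       fe_space common J `<=` H1 (grid_domain J)) :
  forall K : set (R * R), convex_quad K ->
  forall p : {poly {poly R}}, poly_space (F K) p ->
  forall z : R * R, boundary K z -> peval p z = 0.
Proof.
move=> K [a [b [c [d qK]]]] p Pp z /(boundary_edges qK).
have on_edge := vanish_on_segment hF hcommon hH1 _ Pp.
have q1 := quad_rot qK; have q2 := quad_rot q1; have q3 := quad_rot q2.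
by move=> [|||]; apply: on_edge; [exact: qK|exact: q1|exact: q2|exact: q3].
Qed.
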